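(* Let $r,s\in\mathbb{N}$ with $r,s\geq 3$ and $\log_r(s)\notin\mathbb{Q}$, and let $K\subseteq\{1,\ldots,r-2\}$ and $L\subseteq\{1,\ldots,s-2\}$ be nonempty. Then the structure $(\mathbb{R},<,+,C_{r,K},C_{s,L})$ defines (with parameters) every compact set, i.e. every compact subset of $\mathbb{R}^n$ for every $n$.
   Context: For $r\ge 3$ and nonempty $K\subseteq\{1,\ldots,r-2\}$, $C_{r,K}$ is the set of numbers in $[0,1]$ admitting a base $r$ expansion in which none of the digits in $K$ occurs (a base $r$ expansion being an expansion $x=\sum_i a_i r^i$ with digits $a_i\in\{0,\ldots,r-1\}$). *)

(* Defs.v *)
From mathcomp Require Import all_boot all_order all_algebra.
From mathcomp Require Import all_classical all_reals all_analysis.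
Import Order.TTheory GRing.Theory Num.Theory.
Import numFieldNormedType.Exports.

Set Implicit Arguments.
Unset Strict Implicit.
Unset Printing Implicit Defensive.

Local Open Scope classical_set_scope.
Local Open Scope ring_scope.

(* First-order formulas over the signature (<, +, P, Q), P and Q unary, with
   free variables among 'I_n. *)
Inductive term (n : nat) : Type :=
| Var of 'I_n
| Add of term n & term n.

(* The variable bound by [Exi] is ord0; the variable i of the surrounding
   context becomes lift ord0 i in the body. *)
Inductive formula : nat -> Type :=
| Eqt n of term n & term n : formula n
| Ltt n of term n & term n : formula n
| InP n of term n : formula n
| InQ n of term n : formula n
| Neg n of formula n : formula n
| Conj n of formula n & formula n : formula n
| Exi n of formula n.+1 : formula n.

Section Semantics.
Variable R : realType.

Fixpoint eval n (v : 'rV[R]_n) (t : term n) : R :=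
  match t with
  | Var i => v ord0 i
  | Add t1 t2 => eval v t1 + eval v t2
  end.

Variables P Q : set R.

Fixpoint sat n (phi : formula n) : 'rV[R]_n -> Prop :=
  match phi in formula n return 'rV[R]_n -> Prop with
  | Eqt n t1 t2 => fun v => eval v t1 = eval v t2
  | Ltt n t1 t2 => fun v => eval v t1 < eval v t2
  | InP n t => fun v => P (eval v t)
  | InQ n t => fun v => Q (eval v t)
  | Neg n f => fun v => ~ sat f v
  | Conj n f g => fun v => sat f v /\ sat g v
  | Exi n f => fun v => exists y : R, sat f (row_mx (y%:M : 'rV[R]_1) v)
  end.

(* Definability with parameters b in the structure (R, <, +, P, Q). *)
Definition definable n (X : set 'rV[R]_n) : Prop :=
  exists (m : nat) (b : 'rV[R]_m) (phi : formula (n + m)),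
    X = [set x | sat phi (row_mx x b)].

(* The expansion sum_(i <= N) a_i r^i, whose digits are listed from the leading
   one down: [a k] is the digit of weight r ^ (N - k). *)
Definition is_expansion (r : nat) (N : int) (a : nat -> 'I_r) (x : R) : Prop :=
  series (fun k : nat => (a k : nat)%:R * (r%:R : R) ^ (N - k%:Z)) @ \oo --> x.

Definition cantor_set (r : nat) (K : {set 'I_r}) : set R :=
  [set x | 0 <= x <= 1 /\
     exists (N : int) (a : nat -> 'I_r),
       is_expansion N a x /\ forall k, a k \notin K].

End Semantics.

(* Main.v *)
(* A gap of length [l r^-n] in [C_{r,K}] ([l] the length of a longest run of
   digits in [K]) is a gap of level [n]; this makes the powers [r^-n] definable,
   the right ends of the gaps of length at least [l a] are multiples of
   [a = r^-n], and finitely many of them add up to all multiples of [a] in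
   [[0, 1]].  So the base-[r] digits of a real are definable, and every set of
   powers of [r] is coded by a real; likewise for [s].

   The least positive distance from a multiple of [r^-n] to a multiple of [s^-m]
   is [1 / lcm (r^n, s^m)].  With [s^m] the first power above [r^n], the
   logarithm of this lcm grows like [gamma n log r], where
   [gamma = sum_p max (v_p(r) / log r, v_p(s) / log s) log p > 1] because
   [log_r s] is irrational.  This defines, on exponents, a strictly increasing
   [f] with [f n ~ gamma n].  The orbits of [f] cut the exponents into a
   two-dimensional grid whose rows are the blocks [[f^i n0, f^(i+1) n0[], so one
   marked set of exponents codes a whole binary relation.

   Finally the complement of a compact set is a countable union of [rho]-adic
   cells, and the sequence of their digit words is given by finitely many binary
   relations on exponents. *)

Require Import Defs.
From mathcomp Require Import all_boot all_order all_algebra.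
From mathcomp Require Import all_classical all_reals all_analysis.
From mathcomp Require Import zify lra ring.
Import Order.TTheory GRing.Theory Num.Theory.
Import numFieldNormedType.Exports.

Local Open Scope classical_set_scope.
Local Open Scope ring_scope.

Set Implicit Arguments.
Unset Strict Implicit.
Unset Printing Implicit Defensive.

(** * Definable predicates *)

Section Definability.
Variables (R : realType) (P Q : set R).

Definition scons (y : R) (e : nat -> R) : nat -> R :=
  fun i => if i is j.+1 then e j else y.

(* Valuations are infinite sequences, so that predicates of different arities
   combine without reindexing; [dpred_ex] binds the variable 0. *)
Inductive dpred : ((nat -> R) -> Prop) -> Prop :=
| dpred_add0 i j k : dpred (fun e => e i + e j = e k)
| dpred_lt0 i j : dpred (fun e => e i < e j)
| dpred_P0 i : dpred (fun e => P (e i))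
| dpred_Q0 i : dpred (fun e => Q (e i))
| dpred_cst0 i c : dpred (fun e => e i = c)
| dpred_not F : dpred F -> dpred (fun e => ~ F e)
| dpred_and F G : dpred F -> dpred G -> dpred (fun e => F e /\ G e)
| dpred_ex0 F : dpred F -> dpred (fun e => exists y, F (scons y e)).

Lemma dpred_ext F G : (forall e, F e <-> G e) -> dpred F -> dpred G.
Proof. by move=> FG; rewrite (_ : F = G)//; apply/funext => e; exact/propext. Qed.

Lemma dpred_ren (xi : nat -> nat) F : dpred F -> dpred (fun e => F (fun i => e (xi i))).
Proof.
move=> dF; elim: dF xi => {F}.
- by move=> i j k xi; exact: dpred_add0.
- by move=> i j xi; exact: dpred_lt0.
- by move=> i xi; exact: dpred_P0.
- by move=> i xi; exact: dpred_Q0.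
- by move=> i c xi; exact: dpred_cst0.
- by move=> F _ IH xi; exact/dpred_not/IH.
- by move=> F G _ IHF _ IHG xi; exact: dpred_and (IHF _) (IHG _).
- move=> F _ IH xi.
  pose xi' i := if i is j.+1 then (xi j).+1 else 0%N.
  apply: dpred_ext (dpred_ex0 (IH xi')) => e.
  suff E y : (fun i => scons y e (xi' i)) = scons y (fun i => e (xi i)).
    by split=> -[y Fy]; exists y; move: Fy; rewrite E.
  by apply/funext => -[|i].
Qed.

Lemma dpred_ex (G : R -> (nat -> R) -> Prop) :
  dpred (fun e => G (e 0%N) (fun i => e i.+1)) -> dpred (fun e => exists y, G y e).
Proof. by move/dpred_ex0. Qed.

Lemma dpred_or F G : dpred F -> dpred G -> dpred (fun e => F e \/ G e).
Proof.
move=> /dpred_not dF /dpred_not dG; apply: dpred_ext (dpred_not (dpred_and dF dG)) => e.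
by rewrite not_andE !notE.
Qed.

Lemma dpred_imp F G : dpred F -> dpred G -> dpred (fun e => F e -> G e).
Proof.
move=> /dpred_not dF dG; apply: dpred_ext (dpred_or dF dG) => e.
by rewrite implyE.
Qed.

Lemma dpred_iff F G : dpred F -> dpred G -> dpred (fun e => F e <-> G e).
Proof. by move=> dF dG; apply: dpred_and; apply: dpred_imp. Qed.

Lemma dpred_all (G : R -> (nat -> R) -> Prop) :
  dpred (fun e => G (e 0%N) (fun i => e i.+1)) -> dpred (fun e => forall y, G y e).
Proof.
move=> /dpred_not dG.
apply: dpred_ext (dpred_not (@dpred_ex (fun y e => ~ G y e) dG)) => e.
by rewrite -forallNE; split=> H y; have := H y; rewrite notE.
Qed.

(** The graph of [t], with the value in variable 0 and the arguments moved up by one, which is how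
    [dpred_ex] binds. *)
Definition dterm (t : (nat -> R) -> R) := dpred (fun e => t (fun i => e i.+1) = e 0%N).

Lemma dterm_ren (xi : nat -> nat) t : dterm t -> dterm (fun e => t (fun i => e (xi i))).
Proof. by move=> /(dpred_ren (fun i => if i is j.+1 then (xi j).+1 else 0%N)). Qed.

Lemma dpred_subst (G : R -> (nat -> R) -> Prop) t :
  dpred (fun e => G (e 0%N) (fun i => e i.+1)) -> dterm t -> dpred (fun e => G (t e) e).
Proof.
move=> dG dt; apply: dpred_ext (dpred_ex0 (dpred_and dt dG)) => e.
by split=> [[y [<- //]]|Gt]; exists (t e).
Qed.

Lemma dterm_cst c : dterm (fun=> c).
Proof. by apply: dpred_ext (dpred_cst0 0%N c) => e; split=> ->. Qed.

Lemma dpred_add t u v : dterm t -> dterm u -> dterm v ->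
  dpred (fun e => t e + u e = v e).
Proof.
move=> dt du dv.
apply: (@dpred_subst (fun x e => x + u e = v e)) dt.
apply: (@dpred_subst (fun x e => e 0%N + x = v (fun i => e i.+1))); last exact: dterm_ren.
apply: (@dpred_subst (fun x e => e 1%N + e 0%N = x)); last exact: dterm_ren.
exact: dpred_add0.
Qed.

(** Equality of two variables is not a constructor of [dpred]; it comes from addition of the
    constant 0. *)
Lemma dterm_var i : dterm (fun e => e i).
Proof.
apply: (@dpred_ext (fun e => e i.+1 + 0 = e 0%N)); first by move=> e; rewrite addr0.
apply: (@dpred_subst (fun x e => e i.+1 + x = e 0%N)); last exact: dterm_cst.
exact: dpred_add0.
Qed.

Lemma dpred_eq t u : dterm t -> dterm u -> dpred (fun e => t e = u e).
Proof.
move=> dt du; apply: dpred_ext (dpred_add dt (dterm_cst 0) du) => e.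
by rewrite addr0.
Qed.

Lemma dterm_add t u : dterm t -> dterm u -> dterm (fun e => t e + u e).
Proof.
by move=> dt du; apply: dpred_add; [exact: dterm_ren|exact: dterm_ren|exact: dterm_var].
Qed.

Lemma dterm_opp t : dterm t -> dterm (fun e => - t e).
Proof.
move=> dt; apply: (@dpred_ext (fun e => t (fun i => e i.+1) + e 0%N = 0)).
  by move=> e; split=> [/eqP|<-]; rewrite ?subrr // addrC addr_eq0 => /eqP ->.
by apply: dpred_add; [exact: dterm_ren|exact: dterm_var|exact: dterm_cst].
Qed.

Lemma dterm_sub t u : dterm t -> dterm u -> dterm (fun e => t e - u e).
Proof. by move=> dt du; apply: dterm_add dt (dterm_opp du). Qed.

Lemma dterm_natmul k t : dterm t -> dterm (fun e => k%:R * t e).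
Proof.
move=> dt; elim: k => [|k IH].
  by apply: dpred_ext (dterm_cst 0) => e; rewrite mul0r.
by apply: dpred_ext (dterm_add dt IH) => e; rewrite -[k.+1]add1n natrD mulrDl mul1r.
Qed.

Lemma dpred_lt t u : dterm t -> dterm u -> dpred (fun e => t e < u e).
Proof.
move=> dt du; apply: (@dpred_subst (fun x e => x < u e)) dt.
apply: (@dpred_subst (fun x e => e 0%N < x)); last exact: dterm_ren.
exact: dpred_lt0.
Qed.

Lemma dpred_le t u : dterm t -> dterm u -> dpred (fun e => t e <= u e).
Proof.
move=> dt du; apply: dpred_ext (dpred_not (dpred_lt du dt)) => e.
by rewrite leNgt; split=> /negP.
Qed.

Lemma dpred_false : dpred (fun=> False).
Proof.
apply: dpred_ext (dpred_lt (dterm_cst 0) (dterm_cst 0)) => e.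
by rewrite ltxx.
Qed.

Lemma dpred_forall_ord k (F : 'I_k -> (nat -> R) -> Prop) :
  (forall i, dpred (F i)) -> dpred (fun e => forall i, F i e).
Proof.
elim: k F => [|k IH] F dF.
  by apply: dpred_ext (dpred_eq (dterm_cst 0) (dterm_cst 0)) => e; split=> // _ [].
apply: dpred_ext (dpred_and (dF ord0) (IH (fun i => F (lift ord0 i)) _)) => [e|//].
split=> [[F0 FS] i|FA]; last by split.
by case: (unliftP ord0 i) => [j|] ->.
Qed.

(** Quantifying over definable terms instead of variables lets [dsolve] apply an instance to
    compound arguments. *)
Definition dset1 (A : R -> Prop) :=
  forall t, dterm t -> dpred (fun e => A (t e)).
Definition dset2 (A : R -> R -> Prop) :=
  forall t u, dterm t -> dterm u -> dpred (fun e => A (t e) (u e)).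
Definition dset3 (A : R -> R -> R -> Prop) :=
  forall t u v, dterm t -> dterm u -> dterm v -> dpred (fun e => A (t e) (u e) (v e)).

Lemma dset1_P : dset1 P.
Proof.
by move=> t dt; apply: (@dpred_subst (fun x e => P x)) dt; exact: dpred_P0.
Qed.

Lemma dset1_Q : dset1 Q.
Proof.
by move=> t dt; apply: (@dpred_subst (fun x e => Q x)) dt; exact: dpred_Q0.
Qed.

(** Induction on [dpred]; the constants met are collected in [cs] and become parameters. The
    placements [rho] of variables and [kappa] of constants stay general because a quantifier shifts
    both and a conjunction concatenates two lists of constants. *)
Lemma dpred_formula F : dpred F -> exists cs : seq R,
  forall N (rho kappa : nat -> 'I_N), exists phi : formula N,
  forall v : 'rV[R]_N, (forall c, (c < size cs)%N -> v ord0 (kappa c) = nth 0 cs c) ->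
    (F (fun i => v ord0 (rho i)) <-> sat P Q phi v).
Proof.
elim=> {F}.
- move=> i j k; exists [::] => N rho kappa.
  by exists (Eqt (Add (Var (rho i)) (Var (rho j))) (Var (rho k))).
- move=> i j; exists [::] => N rho kappa.
  by exists (Ltt (Var (rho i)) (Var (rho j))).
- by move=> i; exists [::] => N rho kappa; exists (InP (Var (rho i))).
- by move=> i; exists [::] => N rho kappa; exists (InQ (Var (rho i))).
- move=> i c; exists [:: c] => N rho kappa.
  by exists (Eqt (Var (rho i)) (Var (kappa 0%N))) => v /(_ 0%N erefl) /= ->.
- move=> F _ [cs IH]; exists cs => N rho kappa.
  have [phi Hphi] := IH N rho kappa; exists (Neg phi) => v /Hphi /= Fv.
  by split=> nF /Fv.
- move=> F G _ [cs IHF] _ [ds IHG]; exists (cs ++ ds) => N rho kappa.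
  have [phi Hphi] := IHF N rho kappa.
  have [psi Hpsi] := IHG N rho (fun c => kappa (size cs + c)%N).
  exists (Conj phi psi) => v; rewrite size_cat => Hv /=.
  have {}Hphi := Hphi v _; have {}Hpsi := Hpsi v _.
  rewrite -Hphi; last first.
    by move=> c cl; rewrite Hv ?nth_cat ?cl// (leq_trans cl) ?leq_addr.
  rewrite -Hpsi // => c cl.
  by rewrite Hv ?ltn_add2l// nth_cat ltnNge leq_addr /= addKn.
- move=> F _ [cs IH]; exists cs => N rho kappa.
  have [phi Hphi] := IH N.+1 (fun i => if i is j.+1 then lift ord0 (rho j) else ord0)
    (fun c => lift ord0 (kappa c)).
  exists (Exi phi) => v Hv /=.
  have E0 y : row_mx (y%:M : 'rV[R]_1) v ord0 (ord0 : 'I_(1 + N)) = y.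
    have -> : (ord0 : 'I_(1 + N)) = lshift N ord0 by exact/val_inj.
    by rewrite row_mxEl mxE eqxx.
  have ES y i : row_mx (y%:M : 'rV[R]_1) v ord0 (lift ord0 i : 'I_(1 + N)) = v ord0 i.
    have -> : (lift ord0 i : 'I_(1 + N)) = rshift 1 i by exact/val_inj.
    by rewrite row_mxEr.
  have E y : (fun i => row_mx (y%:M : 'rV[R]_1) v ord0
     (if i is j.+1 then lift ord0 (rho j) else ord0 : 'I_(1 + N))) =
     scons y (fun i => v ord0 (rho i)).
    by apply/funext => -[|i] /=; rewrite ?E0 ?ES.
  have {}Hphi y := Hphi (row_mx (y%:M : 'rV[R]_1) v) (fun c cl => etrans (ES y _) (Hv c cl)).
  split=> -[y Fy]; exists y; first by apply/(Hphi y); rewrite E.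
  by rewrite -E; apply/(Hphi y).
Qed.

Lemma dpred_definable n (X : set 'rV[R]_n) (F : (nat -> R) -> Prop) :
  dpred F ->
  (forall x : 'rV[R]_n,
     X x <-> F (fun i => if insub i is Some j then x ord0 j else 0)) ->
  definable P Q X.
Proof.
move=> /dpred_formula[cs H] XF.
(* One entry more than [cs]: the last one, 0 by the default of [nth], is the value of all variables
   of index at least [n]. *)
pose b : 'rV[R]_(size cs).+1 := \row_i nth 0 cs i.
exists (size cs).+1, b.
pose rho i : 'I_(n + (size cs).+1) :=
  if insub i is Some j then lshift _ j else rshift n (inord (size cs)).
have [phi Hphi] := H (n + (size cs).+1)%N rho (fun c => rshift n (inord c)).
exists phi; apply/seteqP; split=> x /=; rewrite XF -Hphi.
- congr F; apply/funext => i; rewrite /rho; case: insubP => [j _ _|_].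
    by rewrite row_mxEl.
  by rewrite row_mxEr mxE inordK// nth_default.
- by move=> c cl; rewrite row_mxEr mxE inordK// ltnS ltnW.
- congr F; apply/funext => i; rewrite /rho; case: insubP => [j _ _|_].
    by rewrite row_mxEl.
  by rewrite row_mxEr mxE inordK// nth_default.
- by move=> c cl; rewrite row_mxEr mxE inordK// ltnS ltnW.
Qed.

End Definability.

(** * Automatic definability proofs *)

Ltac dsolve :=
  lazymatch goal with
  | |- dterm _ _ _ => dsolve_term
  | |- dpred _ _ _ => dsolve_pred
  | |- dset1 _ _ _ => let t := fresh in let dt := fresh in move=> t dt; cbv beta; dsolve_pred
  | |- dset2 _ _ _ => do 2 (let t := fresh in move=> t); do 2 (let t := fresh in move=> t);
      cbv beta; dsolve_pred
  | |- dset3 _ _ _ => do 3 (let t := fresh in move=> t); do 3 (let t := fresh in move=> t);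
      cbv beta; dsolve_pred
  end
with dsolve_term :=
  first
  [ assumption
  | lazymatch goal with
    | |- dterm _ _ (fun e => e _) => apply: dterm_var
    | |- dterm _ _ (fun e => @?t e - @?u e) => apply: (@dterm_sub _ _ _ t u); dsolve_term
    | |- dterm _ _ (fun e => @?t e + @?u e) => apply: (@dterm_add _ _ _ t u); dsolve_term
    | |- dterm _ _ (fun e => - @?t e) => apply: (@dterm_opp _ _ _ t); dsolve_term
    | |- dterm _ _ (fun e => ?t (fun i => e _)) => apply: (@dterm_ren _ _ _ _ t); dsolve_term
    | |- dterm _ _ (fun e => _) => first [apply: dterm_cst | apply: dterm_natmul; dsolve_term]
    end ]
with dsolve_pred :=
  lazymatch goal with
  | |- dpred _ _ (fun e => False) => apply: dpred_false
  | |- dpred _ _ (fun e => ~ _) => apply: dpred_not; dsolve_pred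
  | |- dpred _ _ (fun e => _ /\ _) => apply: dpred_and; dsolve_pred
  | |- dpred _ _ (fun e => _ \/ _) => apply: dpred_or; dsolve_pred
  | |- dpred _ _ (fun e => _ <-> _) => apply: dpred_iff; dsolve_pred
  | |- dpred _ _ (fun e => exists y, _) => apply: dpred_ex; cbv beta; dsolve_pred
  | |- dpred _ _ (fun e => _ = _) => apply: dpred_eq; dsolve_term
  | |- dpred _ _ (fun e => is_true (_ < _)%R) => apply: dpred_lt; dsolve_term
  | |- dpred _ _ (fun e => is_true (_ <= _)%R) => apply: dpred_le; dsolve_term
  | |- dpred _ _ (fun e => forall y, _) =>
      first [apply: dpred_imp; dsolve_pred | apply: dpred_all; cbv beta; dsolve_pred]
  | |- _ =>
      match goal with
      | H : dset1 _ _ _ |- _ => apply H; dsolve_term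
      | H : dset2 _ _ _ |- _ => apply H; dsolve_term
      | H : dset3 _ _ _ |- _ => apply H; dsolve_term
      end
  end.

Ltac nlia :=
  repeat match goal with
  | H : context [@Order.le] |- _ => clear H
  | H : context [@Order.lt] |- _ => clear H
  end; lia.

(** * Self-similarity of the Cantor sets *)

Section CantorSet.
Variables (R : realType) (r : nat) (K : {set 'I_r}).
Hypothesis r3 : (3 <= r)%N.
Hypothesis hK : forall k : 'I_r, k \in K -> (1 <= k <= r - 2)%N.

Let rr : R := r%:R.
Let rr0 : rr != 0. Proof. by rewrite pnatr_eq0 -lt0n; lia. Qed.
Let rr_gt0 : 0 < rr. Proof. by rewrite ltr0n; lia. Qed.
Let rr_gt1 : 1 < rr. Proof. by rewrite ltr1n; lia. Qed.

(** The leading exponent is fixed here, whereas [cantor_set] lets it vary: adding or removing a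
    leading digit moves it by one. *)
Definition avoids_expansion (N : int) (x : R) :=
  exists a : nat -> 'I_r, is_expansion N a x /\ forall k, a k \notin K.

Lemma avoids_expansion_cons N d y : d \notin K ->
  avoids_expansion (N - 1) y -> avoids_expansion N (d%:R * rr ^ N + y).
Proof.
move=> dK [a [ay aK]]; exists (fun k => if k is j.+1 then a j else d); split; last by case.
rewrite /is_expansion -cvg_shiftS /=.
rewrite (_ : (fun n => _) = fun n => d%:R * rr ^ N +
    series (fun k => (a k : nat)%:R * rr ^ (N - 1 - k%:Z)) n); last first.
  apply/funext => n; rewrite /series /= big_nat_recl//= subr0; congr +%R.
  by apply: eq_bigr => i _; rewrite -addn1 PoszD opprD addrA addrAC.
by apply: cvgD => //; exact: cvg_cst.
Qed.

Lemma avoids_expansion_uncons N x : avoids_expansion N x ->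
  exists (d : 'I_r) (y : R),
    [/\ d \notin K, avoids_expansion (N - 1) y & x = d%:R * rr ^ N + y].
Proof.
move=> [a [ax aK]]; exists (a 0%N), (x - (a 0%N)%:R * rr ^ N); split => //.
  exists (fun k => a k.+1); split; last by [].
  move: ax; rewrite /is_expansion -cvg_shiftS /= => ax.
  rewrite (_ : series _ = fun n =>
      series (fun k => (a k : nat)%:R * rr ^ (N - k%:Z)) n.+1 - (a 0%N)%:R * rr ^ N).
    by apply: cvgB => //; exact: cvg_cst.
  apply/funext => n; rewrite /series /= big_nat_recl//= subr0 addrAC subrr add0r.
  by apply: eq_bigr => i _; rewrite -addn1 PoszD opprD addrA addrAC.
by rewrite addrC subrK.
Qed.

Lemma avoids_expansion_scale (M N : int) x :
  avoids_expansion N x -> avoids_expansion (N + M) (rr ^ M * x).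
Proof.
move=> [a [ax aK]]; exists a; split => //; rewrite /is_expansion.
rewrite (_ : series _ = fun n => rr ^ M *
      series (fun k => (a k : nat)%:R * rr ^ (N - k%:Z)) n).
  by apply: cvgM => //; exact: cvg_cst.
apply/funext => n; rewrite /series /= mulr_sumr; apply: eq_bigr => i _.
by rewrite addrAC expfzDr// /rr; ring.
Qed.

Lemma avoids_expansion_bounds N x : avoids_expansion N x -> 0 <= x <= rr ^ (N + 1).
Proof.
move=> [a [ax aK]].
have t0 k : 0 <= (a k)%:R * rr ^ (N - k%:Z).
  by apply: mulr_ge0 => //; apply: exprz_ge0; exact: ltW.
(* Digits are at most [r - 1], and the partial sums with all digits [r - 1] telescope. *)
have S n : 0 <= series (fun k => (a k : nat)%:R * rr ^ (N - k%:Z)) n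
    <= rr ^ (N + 1) - rr ^ (N + 1 - n%:Z).
  rewrite /series /=; elim: n => [|n /andP[IH0 IH]].
    by rewrite big_geq// lexx subr0 subrr lexx.
  rewrite big_nat_recr//= addr_ge0//=.
  have ar : (a n)%:R + 1 <= rr by rewrite natr1 ler_nat.
  apply: le_trans (lerD IH (lexx _)) _.
  rewrite (_ : N + 1 - n.+1%:Z = N - n%:Z); last by lia.
  rewrite (_ : N + 1 - n%:Z = (N - n%:Z) + 1); last by lia.
  rewrite (expfzDr (N - n%:Z) 1)// expr1z.
  have : 0 < rr ^ (N - n%:Z) by exact: exprz_gt0.
  move: ar; rewrite -/rr.
  move: (rr ^ (N - n%:Z)) (rr ^ (N + 1)) ((a n)%:R : R) (rr).
  by move=> A B d q dq A0; nra.
apply/andP; split.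
- rewrite -(cvg_lim _ ax)//; apply: limr_ge; first exact: cvgP ax.
  by apply: nearW => n; case/andP: (S n).
- rewrite -(cvg_lim _ ax)//; apply: limr_le; first exact: cvgP ax.
  apply: nearW => n; case/andP: (S n) => _ /le_trans; apply.
  by rewrite gerBl; apply: exprz_ge0; exact: ltW.
Qed.

Let digit0 : 'I_r := Ordinal (ltnW (ltnW r3)).
Let digit0K : digit0 \notin K. Proof. by apply/negP => /hK. Qed.
Let digit_max_proof : (r.-1 < r)%N. Proof. lia. Qed.
Let digit_max : 'I_r := Ordinal digit_max_proof.
Let digit_maxK : digit_max \notin K. Proof. by apply/negP => /hK /=; lia. Qed.

Lemma avoids_expansion0 N : avoids_expansion N 0.
Proof.
exists (fun=> digit0); split => //; rewrite /is_expansion.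
rewrite (_ : series _ = fun=> 0); first exact: cvg_cst.
by apply/funext => n; rewrite /series /= big1// => i _; rewrite mul0r.
Qed.

(** All digits are [r - 1], which is allowed because [K] stops at [r - 2]. *)
Lemma avoids_expansion1 : avoids_expansion (- 1) 1.
Proof.
exists (fun=> digit_max); split => //; rewrite /is_expansion.
rewrite (_ : series _ = fun n => 1 - (rr^-1) ^+ n).
  rewrite -[X in _ --> X]subr0; apply: cvgB; first exact: cvg_cst.
  by apply: cvg_expr; rewrite gtr0_norm ?invr_gt0// invf_lt1.
apply/funext => n; rewrite /series /=; elim: n => [|n IH].
  by rewrite big_geq// expr0 subrr.
rewrite big_nat_recr//= IH exprS (_ : -1 - n%:Z = - (n.+1%:Z)); last lia.
rewrite -exprnN exprVn exprS.
rewrite (_ : r.-1%:R = rr - 1); last by rewrite -subn1 natrB ?(ltnW (ltnW r3)).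
have X0 : rr ^+ n != 0 by rewrite expf_neq0.
by field; rewrite X0.
Qed.

(** The leading exponent can be normalised to [-1]: the digit 0 is allowed, so zeros can be put in
    front, and for [x < 1] the digits of weight at least 1 vanish. The point 1 has its own
    expansion. *)
Lemma cantor_set_expansion x : cantor_set K x <-> avoids_expansion (- 1) x.
Proof.
split=> [[/andP[x0 x1] [N [a [ax aK]]]]|Ex]; last first.
  split; last by case: Ex => a; exists (- 1)%R, a.
  by have := avoids_expansion_bounds Ex; rewrite addNr expr0z.
have EN : avoids_expansion N x by exists a.
move: x1; rewrite le_eqVlt => /predU1P[->|x1]; first exact: avoids_expansion1.
have up (m : nat) : avoids_expansion (- 1 - m%:Z) x -> avoids_expansion (- 1) x.
  elim: m => [|m IH] Em; first by move: Em; rewrite subr0.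
  apply: IH; rewrite -[x]add0r -(mul0r (rr ^ (- 1 - m%:Z))).
  by apply: (@avoids_expansion_cons _ digit0) => //; rewrite -addrA -opprD -PoszD addn1.
have down (m : nat) : avoids_expansion (- 1 + m%:Z) x -> avoids_expansion (- 1) x.
  elim: m => [|m IH] Em; first by move: Em; rewrite addr0.
  have [d [y [dK Ey xE]]] := avoids_expansion_uncons Em.
  have /andP[y0 _] := avoids_expansion_bounds Ey.
  suff d0 : d = 0%N :> nat.
    apply: IH; move: Ey; rewrite xE d0 mul0r add0r.
    by rewrite (_ : -1 + m.+1%:Z - 1 = -1 + m%:Z); last by lia.
  apply/eqP; rewrite -leqn0 -ltnS -(ltr_nat R).
  apply: le_lt_trans x1; rewrite xE; apply: le_trans (_ : d%:R * rr ^ (- 1 + m.+1%:Z) <= _); last by rewrite lerDl.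
  rewrite (_ : -1 + m.+1%:Z = m%:Z); last lia.
  by rewrite -exprnP ler_peMr// exprn_ege1// ltW.
have [N1|N1] := leP (- 1) N.
  by have := down (absz (N + 1)%R); rewrite (_ : -1 + (absz (N + 1)%R)%:Z = N); [apply|lia].
by have := up (absz (- 1 - N)%R); rewrite (_ : -1 - (absz (- 1 - N)%R)%:Z = N); [apply|lia].
Qed.

Lemma cantor_set_itv (x : R) : cantor_set K x -> 0 <= x <= 1.
Proof. by case. Qed.

Lemma cantor_set0 : cantor_set K (0 : R).
Proof. exact/cantor_set_expansion/avoids_expansion0. Qed.

Lemma cantor_set1 : cantor_set K (1 : R).
Proof. exact/cantor_set_expansion/avoids_expansion1. Qed.

Lemma cantor_set_cons (d : 'I_r) x : d \notin K -> cantor_set K x ->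
  cantor_set K ((d%:R + x) / rr).
Proof.
move=> dK /cantor_set_expansion /(avoids_expansion_scale (- 1)) Ex.
apply/cantor_set_expansion; rewrite mulrDl [x / _]mulrC.
exact: avoids_expansion_cons dK Ex.
Qed.

Lemma cantor_set_uncons x : cantor_set K x ->
  exists (d : 'I_r) (y : R), [/\ d \notin K, cantor_set K y & x = (d%:R + y) / rr].
Proof.
move=> /cantor_set_expansion /avoids_expansion_uncons[d [y [dK Ey ->]]].
exists d, (rr * y); split => //.
  by apply/cantor_set_expansion; have := avoids_expansion_scale 1 Ey; rewrite expr1z addrNK.
by rewrite mulrDl [rr * y]mulrC mulfK.
Qed.

End CantorSet.

(** * Powers of the base and their multiples *)

Section Runs.
Variables (r : nat) (K : {set 'I_r}).
Hypothesis hK : forall k : 'I_r, k \in K -> (1 <= k <= r - 2)%N.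
Hypothesis hK0 : exists k : 'I_r, k \in K.

(** Membership in [K] for natural numbers, so that [i + t] needs no proof of being a digit. *)
Definition has_val (d : nat) : bool := [exists k : 'I_r, (k \in K) && (k == d :> nat)].

Lemma has_val_bounds d : has_val d -> (1 <= d <= r - 2)%N.
Proof. by move=> /existsP[k /andP[/hK ? /eqP <-]]. Qed.

Lemma has_val_ord (d : 'I_r) : has_val d = (d \in K).
Proof.
apply/existsP/idP => [[k /andP[kK /eqP /val_inj <-]]//|dK].
by exists d; rewrite dK eqxx.
Qed.

Lemma max_run : exists i l, [/\ (0 < l)%N, forall t, (t < l)%N -> has_val (i + t) &
  forall j, ~ (forall t, (t <= l)%N -> has_val (j + t))].
Proof.
pose p l := [exists i : 'I_r, [forall t : 'I_l, has_val (i + t)]].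
have p1 : p 1%N.
  have [k kK] := hK0; apply/existsP; exists k; apply/forallP => t.
  by rewrite ord1 addn0 has_val_ord.
have pb l : p l -> (l <= r)%N.
  case: l => // l /existsP[i /forallP H].
  by have /= /has_val_bounds := H ord_max; lia.
case: (ex_maxnP (ex_intro p _ p1) pb) => l /existsP[i /forallP H] max.
exists i, l; split; first exact: max.
  by move=> t tl; exact: (H (Ordinal tl)).
move=> j Hj; have /has_val_bounds jb := Hj 0%N isT.
have jr : (j < r)%N by lia.
suff /max : p l.+1 by rewrite ltnn.
by apply/existsP; exists (Ordinal jr); apply/forallP => t; apply: Hj; rewrite -ltnS.
Qed.

End Runs.

(** * Defining the powers [r^-n] and their multiples from the gaps of the Cantor set *)

Section Base.
Variables (R : realType) (P Q : set R).

Definition npow (r n : nat) : R := (r%:R ^+ n)^-1.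

Definition is_npow (r : nat) (a : R) := exists n, (0 < n)%N /\ a = npow r n.

Definition is_mult (r : nat) (a x : R) :=
  exists n e, [/\ (0 < n)%N, a = npow r n, x = e%:R * a & x <= 1].

Lemma npow_gt0 r n : (0 < r)%N -> 0 < npow r n.
Proof. by move=> r0; rewrite invr_gt0 exprn_gt0 // ltr0n. Qed.

Lemma npowS r n : (0 < r)%N -> r%:R * npow r n.+1 = npow r n.
Proof.
by move=> r0; rewrite /npow exprS invfM mulrA divff ?mul1r// pnatr_eq0 -lt0n.
Qed.

Lemma ltr_npow r m n : (1 < r)%N -> (npow r m < npow r n) = (n < m)%N.
Proof.
move=> r1; rewrite ltf_pV2 ?posrE ?exprn_gt0 ?ltr0n ?(ltnW r1)//.
by rewrite ltr_eXn2l// ltr1n.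
Qed.

Lemma ler_npow r m n : (1 < r)%N -> (npow r m <= npow r n) = (n <= m)%N.
Proof. by move=> r1; rewrite leNgt ltr_npow// -leqNgt. Qed.

Lemma npow_inj r : (1 < r)%N -> injective (npow r).
Proof.
move=> r1 m n E; have := ler_npow m n r1; have := ler_npow n m r1.
by rewrite E lexx; lia.
Qed.

Lemma npow_le1 r n : (0 < r)%N -> npow r n <= 1.
Proof. by move=> r0; rewrite invf_le1 ?exprn_gt0 ?ltr0n// exprn_ege1// ler1n. Qed.

Lemma npow_between r a : (1 < r)%N -> 0 < a <= 1 ->
  exists n, npow r n.+1 < a <= npow r n.
Proof.
move=> r1 /andP[a0 a1].
have r0 : (0 < r)%N by exact: ltnW.
have ex : exists n, npow r n < a.
  exists (Num.truncn a^-1).+1; rewrite -[ltRHS]invrK ltf_pV2 ?posrE ?exprn_gt0 ?ltr0n ?invr_gt0//.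
  apply: (lt_le_trans (truncnS_gt _)); rewrite -natrX ler_nat.
  by rewrite ltnW// ltn_expl.
case: (ex_minnP ex) => -[|n] Hn min.
  by move: Hn; rewrite /npow expr0 invr1 ltNge a1.
exists n; rewrite Hn leNgt; apply/negP => /min; lia.
Qed.

Variables (r : nat) (K : {set 'I_r}) (C : set R).
Hypothesis r3 : (3 <= r)%N.
Hypothesis hK : forall k : 'I_r, k \in K -> (1 <= k <= r - 2)%N.
Hypothesis C_itv : forall x, C x -> 0 <= x <= 1.
Hypothesis C0 : C 0.
Hypothesis C1 : C 1.
Hypothesis C_cons : forall (d : 'I_r) x, d \notin K -> C x -> C ((d%:R + x) / r%:R).
Hypothesis C_uncons : forall x, C x ->
  exists (d : 'I_r) (y : R), [/\ d \notin K, C y & x = (d%:R + y) / r%:R].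
Hypothesis dC : dset1 P Q C.

Let r_gt0 : (0 < r)%N. Proof. lia. Qed.
Let r_gt1 : (1 < r)%N. Proof. lia. Qed.
Let rR0 : r%:R != 0 :> R. Proof. by rewrite pnatr_eq0 -lt0n. Qed.
Let rR_gt0 : 0 < r%:R :> R. Proof. by rewrite ltr0n. Qed.

Local Notation inK := (has_val K).

Variables (i l : nat).
Hypothesis l_gt0 : (0 < l)%N.
Hypothesis run : forall t, (t < l)%N -> inK (i + t).
Hypothesis run_max : forall j, ~ (forall t, (t <= l)%N -> inK (j + t)).

(** The first digit after the run; by maximality neither [k'] nor [i.-1] lies in [K]. *)
Let k' := (i + l)%N.

Let i_gt0 : (0 < i)%N. Proof. by have /(has_val_bounds hK) := run l_gt0; nlia. Qed.
Let k'r : (k' < r)%N.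
Proof. by have /run/(has_val_bounds hK) : (l.-1 < l)%N; rewrite /k'; nlia. Qed.
Let k'K : ~~ inK k'.
Proof.
apply/negP => Kk; apply: (run_max (j := i)) => t; rewrite leq_eqVlt => /predU1P[->//|].
exact: run.
Qed.
Let iK : ~~ inK i.-1.
Proof.
apply/negP => Ki; apply: (run_max (j := i.-1)) => -[|t] tl; first by rewrite addn0.
by rewrite addnS -addSn prednK//; exact: run.
Qed.
Let notinK0 : ~~ inK 0. Proof. by apply/negP => /(has_val_bounds hK). Qed.

(** [w] is the value of a word of [n] base-[r] digits, none of them in [K]. *)
Fixpoint good (n w : nat) : bool :=
  if n is m.+1 then good m (w %/ r) && ~~ inK (w %% r) else w == 0%N.

Lemma good_rcons n w d : (d < r)%N -> good n w -> ~~ inK d -> good n.+1 (w * r + d).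
Proof.
by move=> dr gw gd; rewrite /= divnMDl// divn_small// addn0 gw modnMDl modn_small.
Qed.

Lemma C_good n w y : good n w -> C y -> C ((w%:R + y) * npow r n).
Proof.
elim: n w y => [|n IH] w y /=.
  by move=> /eqP-> Cy; rewrite add0r /npow expr0 invr1 mulr1.
move=> /andP[gw gd] Cy.
have dr : (w %% r < r)%N by exact: ltn_pmod.
have := IH _ _ gw (@C_cons (Ordinal dr) y _ Cy).
rewrite -has_val_ord => /(_ gd) /=; congr C.
rewrite [in RHS](divn_eq w r) natrD natrM -(npowS n r_gt0); field.
exact: rR0.
Qed.

Lemma C_ungood n x : C x -> exists w y, [/\ good n w, C y & x = (w%:R + y) * npow r n].
Proof.
elim: n x => [|n IH] x Cx.
  by exists 0%N, x; rewrite /npow expr0 invr1 mulr1 add0r.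
have [w [y [gw /C_uncons[d [z [dK Cz ->]]] ->]]] := IH _ Cx.
exists (w * r + d)%N, z; split => //; first by rewrite good_rcons// has_val_ord.
rewrite natrD natrM -(npowS n r_gt0); field; exact: rR0.
Qed.

(** A point of [C] in between would have an admissible prefix of [n + 1] digits ending in a digit of
    the run. *)
Lemma C_gap n w x : C x ->
  (w * r + i)%:R * npow r n.+1 < x -> x < (w * r + k')%:R * npow r n.+1 -> False.
Proof.
move=> Cx.
have [u [y [/andP[_ gu] /C_itv/andP[y0 y1] ->]]] := C_ungood n.+1 Cx.
rewrite !ltr_pM2r ?npow_gt0// => lo hi.
have ulo : (w * r + i <= u)%N.
  rewrite -ltnS -(ltr_nat R) -natr1; apply: lt_le_trans lo _; lra.
have uhi : (u < w * r + k')%N.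
  by rewrite -(ltr_nat R); apply: le_lt_trans hi; rewrite lerDl.
have E : (u %% r = i + (u - (w * r + i)))%N.
  rewrite -[in LHS](subnKC ulo) -addnA modnMDl modn_small//.
  by apply: leq_trans k'r; rewrite ltnS -(leq_add2l (w * r)) addnA subnKC// ltnW.
by move: gu; rewrite E run// ltn_subLR// -addnA.
Qed.

Fixpoint rep (n : nat) : nat := if n is m.+1 then (rep m * r + k')%N else 0%N.

Lemma good_rep n : good n (rep n).
Proof. by elim: n => // n IH; exact: good_rcons. Qed.

(** The number with all digits [k']. Its truncation after [n] digits is [p * (1 - a)] for
    [a = r^-n], which is linear in [a] and so can be named in a formula. *)
Let p : R := k'%:R / (r - 1)%:R.
Let r1R0 : (r - 1)%:R != 0 :> R. Proof. by rewrite pnatr_eq0; nlia. Qed.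

Lemma rep_npow n : (rep n)%:R * npow r n = p * (1 - npow r n).
Proof.
elim: n => [|n IH] /=; first by rewrite /npow expr0 invr1 subrr mul0r mulr0.
have -> : (rep n * r + k')%:R * npow r n.+1 = (rep n)%:R * npow r n + k'%:R * npow r n.+1.
  by rewrite natrD natrM mulrDl -mulrA npowS.
rewrite {}IH -(npowS n r_gt0) /p; move: r1R0; rewrite natrB// => ?; field.
by [].
Qed.

(** With [e] the integer part of [U * r], the points [(e + 1 + t) / r], [t < l], lie between [U] and
    [V]. One of [e, ..., e + l] is outside [K]: if it is [e + t] with [t < l], the right end of its
    cylinder is such a point (as 1 is in [C]); if it is [e + l], the left end is (as 0 is in
    [C]). *)
Lemma C_dense U V : 0 <= U -> V <= 1 -> l%:R < (V - U) * r%:R ->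
  exists c, [/\ C c, U < c & c < V].
Proof.
move=> U0 V1 UV.
have rU0 : 0 <= U * r%:R by exact: mulr_ge0 (ltW _).
have [e /andP[e1 e2]] : exists e : nat, e%:R <= U * r%:R < e.+1%:R.
  by exists (Num.truncn (U * r%:R)); exact: truncn_itv.
have hi t : (t < l)%N -> (e.+1 + t)%:R < V * r%:R.
  move=> tl; have : ((e + t).+1)%:R <= e%:R + l%:R :> R by rewrite -natrD ler_nat; nlia.
  by rewrite addSn; lra.
have pt t : (t < l)%N -> C ((e.+1 + t)%:R / r%:R) -> exists c, [/\ C c, U < c & c < V].
  move=> tl Ct; exists ((e.+1 + t)%:R / r%:R); split => //.
    rewrite ltr_pdivlMr//; apply: lt_le_trans e2 _; by rewrite ler_nat leq_addr.
  by rewrite ltr_pdivrMr//; exact: hi.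
have lt t : (t < l)%N -> (e.+1 + t < r)%N.
  move=> tl; rewrite -(ltr_nat R); apply: lt_le_trans (hi _ tl) _.
  by rewrite ler_piMl// ltW.
case: (pselect (forall t, (t <= l)%N -> inK (e + t))) => [/run_max//|].
move=> /existsNP[t] /not_implyP[tl /negP nK].
have [tl'|tl'] := ltnP t l.
  have dr := lt _ tl'; have dr' : (e + t < r)%N by nlia.
  apply: (pt t) => //.
  have := @C_cons (Ordinal dr') 1 _ C1; rewrite -has_val_ord => /(_ nK) /=.
  by rewrite natr1 addSn.
have tE : t = l.-1.+1 by nlia.
have tl2 : (l.-1 < l)%N by nlia.
apply: (pt l.-1) => //.
have := @C_cons (Ordinal (lt _ tl2)) 0 _ C0; rewrite -has_val_ord /= addr0; apply.
by rewrite addSn -addnS -tE.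
Qed.

(** For [a = r^-n], [l * a] is the length of a gap of level [n]. *)
Definition gap_left (a v : R) := C v /\ forall x, C x -> v - l%:R * a < x -> x < v -> False.

(** For [a = r^-n] the point [p * (1 - a)] is the right end of a gap of length exactly [l * a]. For
    [a] strictly between two powers, the same gap would be too long for the cylinder that contains
    it. *)
Lemma is_npowP a : is_npow r a <->
  [/\ 0 < a, a <= 1, C (p * (1 - a) - l%:R * a) & gap_left a (p * (1 - a))].
Proof.
split=> [[n [n0 ->]]|].
  case: n n0 => // n _; rewrite /gap_left -rep_npow /=.
  have E : (rep n * r + k')%:R * npow r n.+1 - l%:R * npow r n.+1 =
      (rep n * r + i)%:R * npow r n.+1.
    by rewrite -mulrBl /k' addnA natrD addrK.
  split; rewrite ?npow_gt0 ?npow_le1 ?E//.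
    have := @C_good n.+1 (rep n * r + i.-1) 1 _ C1.
    rewrite natr1 -addnS prednK//; apply; apply: good_rcons (good_rep n) iK.
    by move: k'r; rewrite /k'; nlia.
  split; first by have := C_good (good_rep n.+1) C0; rewrite addr0.
  move=> x Cx; exact: C_gap Cx.
move=> [a0 a1 Cu [Cv gap]].
have [|n /andP[na an]] := @npow_between r a r_gt1; first by rewrite a0.
move: an; rewrite le_eqVlt => /predU1P[aE|an].
  (* Exponent 0, that is [a = 1], is excluded because the left end of the gap would be [- l]. *)
  case: n aE {na} => [|n] aE; last by exists n.+1.
  move: Cu; rewrite aE /npow expr0 invr1 subrr mulr0 mulr1 sub0r => /C_itv/andP[].
  by rewrite oppr_ge0 lern0; nlia.
exfalso.
have p0 : 0 < p by rewrite divr_gt0 ?ltr0n /k'; nlia.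
have p1 : p <= 1 by rewrite ler_pdivrMr ?ltr0n ?mul1r ?ler_nat; nlia.
set v := p * (1 - a) in Cu Cv gap.
have Cn : C (p * (1 - npow r n)) by have := C_good (good_rep n) C0; rewrite addr0 rep_npow.
have vn : p * (1 - npow r n) < v by rewrite ltr_pM2l// ltrD2l ltrN2.
have un : p * (1 - npow r n) <= v - l%:R * a by rewrite leNgt; apply/negP => /(gap _ Cn); apply.
have nn0 := @npow_gt0 r n r_gt0.
(* [f] maps the cylinder of the word [rep n] onto [[0, 1]]; the image of the gap is longer than
   [l / r] because [a > r^-(n+1)], so it meets [C]. *)
pose f x := (x - p * (1 - npow r n)) / npow r n.
have [c [Cc c1 c2]] : exists c, [/\ C c, f (v - l%:R * a) < c & c < f v].
  apply: C_dense; rewrite /f.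
  - by rewrite divr_ge0 ?subr_ge0// ltW.
  - rewrite ler_pdivrMr// mul1r /v -mulrBr.
    apply: le_trans (_ : 1 - a - (1 - npow r n) <= _); last lra.
    by rewrite ler_piMl//; lra.
  - rewrite -mulrBl (_ : v - _ - _ = l%:R * a); last by ring.
    have q0 : 0 < npow r n.+1 by exact: npow_gt0.
    rewrite [ltRHS](_ : _ = l%:R * (a / npow r n.+1)).
      by rewrite ltr_pMr ?ltr0n// ltr_pdivlMr// mul1r.
    by rewrite -(npowS n r_gt0); field; rewrite rR0 gt_eqF.
apply: (gap ((c + (rep n)%:R) * npow r n)).
- by rewrite addrC; exact: C_good (good_rep n) Cc.
- by rewrite mulrDl rep_npow; move: c1; rewrite /f ltr_pdivrMr//; lra.
- by rewrite mulrDl rep_npow; move: c2; rewrite /f ltr_pdivlMr//; lra.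
Qed.

(** Write [v = (w + y) r^-n] with [y] in [C]. If [0 < y < 1], the point [w r^-n] of [C] is less than
    [l r^-n] to the left of [v]. *)
Lemma gap_left_mult n v : gap_left (npow r n) v -> exists e : nat, v = e%:R * npow r n.
Proof.
move=> [Cv gap].
have [w [y [gw Cy vE]]] := C_ungood n Cv.
have [y0|y0] := eqVneq y 0; first by exists w; rewrite vE y0 addr0.
have [y1|y1] := eqVneq y 1; first by exists w.+1; rewrite vE y1 natr1.
exfalso; apply: (gap (w%:R * npow r n)).
- by have := C_good gw C0; rewrite addr0.
- rewrite vE -mulrBl ltr_pM2r ?npow_gt0//.
  have /andP[_ y_le1] := C_itv Cy.
  have : 1 <= l%:R :> R by rewrite ler1n.
  have : y < 1 by rewrite lt_neqAle y1.
  lra.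
- rewrite vE ltr_pM2r ?npow_gt0// ltrDl lt_neqAle eq_sym y0 /=.
  by case/andP: (C_itv Cy).
Qed.

Fixpoint binary (n w : nat) : Prop :=
  if n is m.+1 then exists w' c, [/\ binary m w', (c <= 1)%N & w = (w' * r + c)%N]
  else w = 0%N.

(** Each digit [c] of [e] is spread over the [r - 1] summands as [c] ones and [r - 1 - c] zeros. *)
Lemma binary_sum n e : (e < r ^ n)%N ->
  exists g : 'I_(r - 1) -> nat, (forall d, binary n (g d)) /\ (\sum_d g d = e)%N.
Proof.
elim: n e => [|n IH] e.
  rewrite expn0 ltnS leqn0 => /eqP->; exists (fun=> 0%N); split=> //.
  by rewrite big1.
rewrite expnSr => er; have er' : (e %/ r < r ^ n)%N by rewrite ltn_divLR.
have [g [bg sg]] := IH _ er'.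
exists (fun d => (g d * r + (d < e %% r))%N); split.
  by move=> d; exists (g d), (d < e %% r)%N; split => //; case: (_ < _)%N.
rewrite big_split /= -big_distrl /= sg [in RHS](divn_eq e r); congr addn.
have -> : forall c N, (\sum_(d < N) (d < c) = minn c N)%N.
  move=> c; elim=> [|N IHN]; first by rewrite big_ord0 minn0.
  by rewrite big_ord_recr /= IHN; nlia.
have : (e %% r < r)%N by exact: ltn_pmod.
nlia.
Qed.

(** The digits of [k' * w] are 0 and [k']. A last nonzero digit [k'] at place [j <= n] has a gap of
    level [j] on its left, at least as long as one of level [n]; at 0 there is nothing to check, as
    [C] has no negative points. *)
Lemma binary_good n w : binary n w ->
  good n (k' * w) /\ gap_left (npow r n) ((k' * w)%:R * npow r n).
Proof.
elim: n w => [|n IH] w /=.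
  move=> ->; rewrite muln0 mul0r; split=> //; split=> // x /C_itv/andP[x0 _] _.
  by rewrite ltNge x0.
move=> [w' [c [bw' c1 ->]]].
have [gw [Cw gapw]] := IH _ bw'.
have c01 : c = 0%N \/ c = 1%N by nlia.
have g : good n.+1 (k' * (w' * r + c)).
  rewrite mulnDr mulnA; apply: good_rcons => //; first by case: c01 => ->; nlia.
  by case: c01 => ->; rewrite ?muln0 ?muln1.
split; first exact: g.
split; first by have := C_good g C0; rewrite addr0.
case: c01 => -> x Cx.
  rewrite addn0 mulnA natrM -mulrA npowS// => lo; apply: gapw Cx _.
  apply: le_lt_trans lo; rewrite lerD2l lerN2 -(npowS n r_gt0) ler_pM2l ?ltr0n//.
  by rewrite ler_peMl ?ler1n// ltW// npow_gt0.
rewrite mulnDr mulnA muln1 -mulrBl -natrB; last by rewrite /k'; nlia.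
by rewrite (_ : _ - l = k' * w' * r + i)%N; [exact: C_gap Cx|rewrite /k'; nlia].
Qed.

Fixpoint sum_gap (k : nat) (a x : R) : Prop :=
  if k is j.+1 then exists y, (gap_left a y \/ y = a) /\ sum_gap j a (x - y) else x = 0.

Lemma sum_gap_add j k a x y : sum_gap j a x -> sum_gap k a y -> sum_gap (j + k) a (x + y).
Proof.
elim: j x => [|j IH] x /=; first by move=> -> ; rewrite add0r.
move=> [z [gz sz]] sy; exists z; split=> //.
by rewrite addrAC; exact: IH.
Qed.

Lemma sum_gap_sum k a (g : 'I_k -> R) : (forall d, gap_left a (g d)) ->
  sum_gap k a (\sum_d g d).
Proof.
elim: k g => [|k IH] g gg; first by rewrite big_ord0.
rewrite big_ord_recl; exists (g ord0); split; first by left.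
by rewrite addrAC subrr add0r; exact: IH.
Qed.

Lemma gap_left0 a : gap_left a 0.
Proof. by split=> // x /C_itv/andP[x0 _] _; rewrite ltNge x0. Qed.

Lemma sum_gap_self c k n : (c <= k)%N -> sum_gap k (npow r n) (c%:R * npow r n).
Proof.
elim: k c => [|k IH] [|c]//= ck.
- by rewrite mul0r.
- exists 0; split; first by left; exact: gap_left0.
  by rewrite subr0; exact: IH.
- exists (npow r n); split; first by right.
  by rewrite -natr1 mulrDl mul1r addrK; exact: IH.
Qed.

(** Divide [e] by [k']: the quotient is a sum of [r - 1] numbers with digits 0 and 1, whose
    [k']-multiples are right ends of gaps, and the remainder is fewer than [k'] copies of [a]. *)
Lemma is_multP a x : is_mult r a x <->
  [/\ is_npow r a, x <= 1 & sum_gap (r - 1 + k') a x].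
Proof.
split=> [[n [e [n0 aE -> e1]]]|[[n [n0 ->]] x1 sx]].
  split => //; first by exists n.
  have en : (e <= r ^ n)%N.
    move: e1; rewrite aE /npow ler_pdivrMr ?exprn_gt0// mul1r -natrX ler_nat //.
  (* This keeps the quotient below [r ^ n] even for [e = r ^ n]. *)
  have k2 : (1 < k')%N by move: i_gt0 l_gt0; rewrite /k'; nlia.
  have qr : (e %/ k' < r ^ n)%N.
    by apply: leq_ltn_trans (leq_div2r k' en) (ltn_Pdiv k2 _); rewrite expn_gt0 r_gt0.
  have [g [bg sg]] := binary_sum qr.
  rewrite (divn_eq e k') natrD mulrDl aE; apply: sum_gap_add; last first.
    by apply: sum_gap_self; rewrite ltnW// ltn_pmod//; nlia.
  rewrite -sg big_distrl /= natr_sum mulr_suml.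
  apply: sum_gap_sum => d; rewrite mulnC.
  by case: (binary_good (bg d)).
exists n; suff [e xE] : exists e : nat, x = e%:R * npow r n by exists e.
move: (r - 1 + k')%N sx {x1} => k; elim: k x => [|k IH] x /=.
  by move=> ->; exists 0%N; rewrite mul0r.
move=> [y [gy /IH[e xE]]].
have [e' yE] : exists e : nat, y = e%:R * npow r n.
  by case: gy => [/gap_left_mult//|->]; exists 1%N; rewrite mul1r.
by exists (e + e')%N; rewrite natrD mulrDl -xE -yE subrK.
Qed.

Lemma dset2_gap_left : dset2 P Q gap_left.
Proof. by rewrite /gap_left; dsolve. Qed.

Lemma dset1_is_npow0 : dset1 P Q (is_npow r).
Proof.
move=> t dt; have dG := dset2_gap_left.
(* Only natural multiples are available as terms, so [p * (1 - t e)] enters as the [v] solving an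
   equation without division. *)
apply: (@dpred_ext _ _ _ (fun e => 0 < t e /\ t e <= 1 /\ exists v, (r - 1)%:R * v = k'%:R * (1 - t e) /\
   C (v - l%:R * t e) /\ gap_left (t e) v)); last by dsolve.
move=> e; rewrite is_npowP; split=> [[? [? [v [vE [Cv gv]]]]]|[? ? ? ?]].
  have E : v = p * (1 - t e) by rewrite /p mulrAC -vE mulrC mulKf.
  by rewrite -E.
do 2 (split => //); exists (p * (1 - t e)); split => //.
by rewrite /p mulrAC mulrC mulfVK.
Qed.

Lemma dset2_is_mult0 : dset2 P Q (is_mult r).
Proof.
have dA := dset1_is_npow0; have dG := dset2_gap_left.
have dS : forall k, dset2 P Q (sum_gap k).
  by elim=> [|k IH] /=; dsolve.
have {}dS := dS (r - 1 + k')%N => t u dt du.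
apply: (@dpred_ext _ _ _ (fun e => is_npow r (t e) /\ u e <= 1 /\
   sum_gap (r - 1 + k') (t e) (u e))); last by dsolve.
by move=> e; rewrite is_multP; split=> [[? []]|[]].
Qed.

End Base.

Arguments npow {R} r n.

(** * Growth of the lcm of two powers *)

Section Growth.
Variables (R : realType) (r s : nat).
Hypothesis r2 : (2 <= r)%N.
Hypothesis s2 : (2 <= s)%N.
Hypothesis hlog : @irrational R (ln (s%:R : R) / ln (r%:R : R)).

Let lnr : R := ln r%:R.
Let lns : R := ln s%:R.
Let lnr_gt0 : 0 < lnr. Proof. by apply: ln_gt0; rewrite ltr1n. Qed.
Let lns_gt0 : 0 < lns. Proof. by apply: ln_gt0; rewrite ltr1n. Qed.
Let ps := primes (r * s).

Lemma ln_prod_primes (qs : seq nat) (e : nat -> nat) : all prime qs ->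
  ln ((\prod_(p <- qs) p ^ e p)%:R : R) = \sum_(p <- qs) (e p)%:R * ln p%:R.
Proof.
elim: qs => [|q qs IH] /=; first by rewrite !big_nil ln1.
move=> /andP[/prime_gt0 q0 /[dup] pqs /IH {}IH]; rewrite !big_cons natrM lnM ?posrE ?ltr0n.
- by rewrite IH natrX lnXn ?ltr0n// mulr_natl.
- by rewrite expn_gt0 q0.
- rewrite big_seq; apply: prodn_cond_gt0 => p pq.
  by move/allP: pqs => /(_ _ pq)/prime_gt0 p0; rewrite expn_gt0 p0.
Qed.

Lemma ln_primes n : (0 < n)%N -> {subset primes n <= ps} ->
  ln (n%:R : R) = \sum_(p <- ps) (logn p n)%:R * ln p%:R.
Proof.
move=> n0 sub.
rewrite -ln_prod_primes; last by apply/allP => p; rewrite mem_primes => /and3P[].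
congr (ln _%:R).
have -> : (\prod_(p <- ps) p ^ logn p n = \prod_(p <- primes n) p ^ logn p n)%N.
  rewrite (bigID (fun p => p \in primes n)) /= [X in (_ * X)%N]big1 ?muln1; last first.
    move=> p; rewrite -logn_gt0 -leqNgt leqn0 => /eqP ->; exact: expn0.
  rewrite -big_filter; apply: perm_big; apply: uniq_perm.
  - by rewrite filter_uniq// primes_uniq.
  - exact: primes_uniq.
  - by move=> p; rewrite mem_filter; case: (boolP (p \in primes n)) => //= /sub.
rewrite [in LHS](prod_prime_decomp n0) prime_decompE big_map.
by apply: eq_bigr => p _.
Qed.

(** The share of the prime [p] in [ln r], and below in [ln s]; each family of shares sums to 1. The
    maximum in [gamma] mirrors the exponents of an lcm. *)
Let alpha p : R := (logn p r)%:R * ln p%:R / lnr.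
Let beta p : R := (logn p s)%:R * ln p%:R / lns.
Let gamma : R := \sum_(p <- ps) Num.max (alpha p) (beta p).

Let sub_r : {subset primes r <= ps}.
Proof. by move=> p; rewrite /ps primesM ?(ltnW r2) ?(ltnW s2)// => ->. Qed.
Let sub_s : {subset primes s <= ps}.
Proof. by move=> p; rewrite /ps primesM ?(ltnW r2) ?(ltnW s2)// => ->; rewrite orbT. Qed.

Let sum_alpha : \sum_(p <- ps) alpha p = 1.
Proof. by rewrite -mulr_suml -ln_primes ?divff ?gt_eqF// ltnW. Qed.
Let sum_beta : \sum_(p <- ps) beta p = 1.
Proof. by rewrite -mulr_suml -ln_primes ?divff ?gt_eqF// ltnW. Qed.

Let lnp_ge0 p : 0 <= ln (p%:R : R).
Proof. by case: p => [|p]; [rewrite ln0|rewrite ln_ge0// ler1n]. Qed.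
Let alpha_ge0 p : 0 <= alpha p.
Proof. by rewrite divr_ge0 ?mulr_ge0// ltW. Qed.
Let beta_ge0 p : 0 <= beta p.
Proof. by rewrite divr_ge0 ?mulr_ge0// ltW. Qed.

(* If [alpha] and [beta] agreed, comparing them at a prime divisor of [r] would
   make [ln s / ln r] rational. *)
Lemma gamma_gt1 : 1 < gamma.
Proof.
(* Both families sum to 1, so [gamma] is 1 plus half the sum of the [|alpha p - beta p|]. *)
have maxE p : Num.max (alpha p) (beta p) = (alpha p + beta p + `|alpha p - beta p|) / 2.
  by rewrite maxr_absE.
rewrite /gamma (eq_bigr _ (fun p _ => maxE p)) -mulr_suml !big_split /= sum_alpha sum_beta.
rewrite ltr_pdivlMr// mul1r ltrDl lt_neqAle eq_sym sumr_ge0 ?andbT//.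
apply/negP; rewrite psumr_eq0// => /allP H.
apply: hlog => /=.
pose p := pdiv r.
have pr : prime p by exact: pdiv_prime.
have pps : p \in ps by apply: sub_r; rewrite mem_primes pr (ltnW r2) pdiv_dvd.
have lp0 : ln (p%:R : R) != 0 by rewrite gt_eqF// ln_gt0// ltr1n prime_gt1.
have v0 : (logn p r)%:R != 0 :> R.
  by rewrite pnatr_eq0 -lt0n logn_gt0 mem_primes pr (ltnW r2) pdiv_dvd.
have := H _ pps; rewrite /= normr_eq0 subr_eq0 => /eqP.
rewrite /alpha /beta -/lnr -/lns => E.
have {}E : lns / lnr = (logn p s)%:R / (logn p r)%:R.
  move: E; rewrite -!mulrA => /(congr1 (fun x => x * lns / (ln p%:R))).
  have ? : lnr != 0 by rewrite gt_eqF.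
  have ? : lns != 0 by rewrite gt_eqF.
  move=> E; apply: (mulfI v0); rewrite [RHS]mulrC divfK//.
  transitivity ((logn p r)%:R * (ln p%:R / lnr) * lns / ln p%:R); first by field; rewrite lp0.
  by rewrite E; field; rewrite lp0.
rewrite E; exists ((logn p s)%:R / (logn p r)%:R) => //.
by rewrite fmorph_div /= !ratr_nat.
Qed.

(** The logarithm of the lcm is the sum over [p] of the larger of [N ln r alpha p] and
    [m ln s beta p]. Replacing [m ln s] by [N ln r] costs at most [ln s * beta p] in each term,
    hence [ln s] in all. *)
Lemma ln_lcm_bounds (N m : nat) : N%:R * lnr <= m%:R * lns -> m%:R * lns <= N%:R * lnr + lns ->
  N%:R * lnr * gamma <= ln ((lcmn (r ^ N) (s ^ m))%:R : R) <= N%:R * lnr * gamma + lns.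
Proof.
move=> lo hi.
have rN0 : (0 < r ^ N)%N by rewrite expn_gt0 (ltnW r2).
have sm0 : (0 < s ^ m)%N by rewrite expn_gt0 (ltnW s2).
rewrite ln_primes ?lcmn_gt0 ?rN0//; last first.
  move=> p; rewrite !mem_primes lcmn_gt0 rN0 sm0 muln_gt0 (ltnW r2) (ltnW s2) /=.
  move=> /andP[pp pl]; rewrite pp Euclid_dvdM//=.
  have : (p %| r ^ N * s ^ m)%N by rewrite (dvdn_trans pl)// dvdn_lcm dvdn_mulr ?dvdn_mull.
  by rewrite Euclid_dvdM// !Euclid_dvdX//; case/orP => /andP[-> _]; rewrite ?orbT.
have tE p : (logn p (lcmn (r ^ N) (s ^ m)))%:R * ln p%:R =
    Num.max (N%:R * lnr * alpha p) (m%:R * lns * beta p).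
  rewrite logn_lcm// !lognX natr_max maxr_pMl//.
  have ? : lnr != 0 by rewrite gt_eqF.
  have ? : lns != 0 by rewrite gt_eqF.
  congr Num.max; rewrite natrM /alpha /beta; field => //.
rewrite (eq_bigr _ (fun p _ => tE p)) /gamma.
have Nr0 : 0 <= N%:R * lnr by rewrite mulr_ge0// ltW.
apply/andP; split.
  rewrite mulr_sumr; apply: ler_sum => p _; rewrite maxr_pMr//.
  rewrite ge_max le_max lexx /= le_max; apply/orP; right.
  exact: ler_wpM2r.
have sb : lns = \sum_(p <- ps) lns * beta p by rewrite -mulr_sumr sum_beta mulr1.
rewrite [X in _ + X]sb mulr_sumr -big_split /=; apply: ler_sum => p _.
rewrite maxr_pMr// ge_max; apply/andP; split.
  apply: ler_wpDr; last by rewrite le_max lexx.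
  by rewrite mulr_ge0// ltW.
apply: (le_trans (ler_wpM2r (beta_ge0 p) hi)); rewrite mulrDl lerD2r.
by rewrite le_max lexx orbT.
Qed.

Definition lcm_shift (rho n : nat) : nat :=
  trunc_log rho (lcmn (rho ^ n) (s ^ up_log s (rho ^ n))).

Section Power.
Variable S : nat.
Hypothesis S_gt0 : (0 < S)%N.
Let rho := (r ^ S)%N.
Let eps : R := lns / (S%:R * lnr).
Let f := lcm_shift rho.
Let rho_gt1 : (1 < rho)%N.
Proof. by rewrite -(expn0 r) ltn_exp2l. Qed.
Let SR0 : 0 < S%:R * lnr. Proof. by rewrite mulr_gt0// ltr0n. Qed.

(** In units of [ln rho = S ln r] the error [ln s] becomes [eps], which a large [S] makes small;
    truncation loses less than 1. *)
Lemma lcm_shift_bounds n : n%:R * gamma < (f n).+1%:R /\ (f n)%:R <= n%:R * gamma + eps.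
Proof.
set m := up_log s (rho ^ n).
have rn0 : (0 < rho ^ n)%N by rewrite expn_gt0 (ltnW rho_gt1).
have sm0 : (0 < s ^ m)%N by rewrite expn_gt0 (ltnW s2).
have lnX (a b : nat) : (0 < a)%N -> ln ((a ^ b)%:R : R) = b%:R * ln a%:R.
  by move=> a0; rewrite natrX lnXn ?ltr0n// mulr_natl.
have rnE : (rho ^ n = r ^ (S * n))%N by rewrite expnM.
have lo : (S * n)%:R * lnr <= m%:R * lns.
  rewrite -!lnX ?(ltnW r2) ?(ltnW s2)// -rnE ler_ln ?posrE ?ltr0n// ler_nat.
  exact: up_logP.
have hi : m%:R * lns <= (S * n)%:R * lnr + lns.
  have [n0|n0] := posnP n.
    by rewrite /m n0 expn0 up_log1 muln0 !mul0r add0r ltW.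
  have rn1 : (1 < rho ^ n)%N by rewrite -(expn0 rho) ltn_exp2l.
  have h : ln ((s ^ m.-1)%:R : R) <= ln (r ^ (S * n))%:R.
    rewrite ler_ln ?posrE ?ltr0n ?expn_gt0 ?(ltnW s2) ?(ltnW r2)// ler_nat -rnE ltnW//.
    exact: up_log_gtn.
  rewrite !lnX ?(ltnW r2) ?(ltnW s2)// in h.
  have mE : m = m.-1.+1 by rewrite prednK// up_log_gt0 s2.
  by rewrite mE -natr1 mulrDl mul1r lerD2r.
have /andP[] := ln_lcm_bounds lo hi; rewrite -rnE.
have l0 : (0 < lcmn (rho ^ n) (s ^ m))%N by rewrite lcmn_gt0 rn0.
have /andP[flo fhi] := trunc_log_bounds rho_gt1 l0; rewrite -/(f n) in flo fhi.
have {}flo : ln ((rho ^ f n)%:R : R) <= ln (lcmn (rho ^ n) (s ^ m))%:R.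
  by rewrite ler_ln ?ler_nat// posrE ltr0n// expn_gt0 (ltnW rho_gt1).
have {}fhi : ln (lcmn (rho ^ n) (s ^ m))%:R < ln ((rho ^ (f n).+1)%:R : R).
  by rewrite ltr_ln ?ltr_nat// posrE ltr0n// expn_gt0 (ltnW rho_gt1).
move: flo fhi; rewrite !(lnX rho) ?(ltnW rho_gt1)// (lnX r S) ?(ltnW r2)// -/lnr.
move: (ln (lcmn _ _)%:R) => X flo fhi glo ghi.
have SE : (S * n)%:R * lnr = n%:R * (S%:R * lnr) by rewrite natrM; ring.
rewrite {}SE in glo ghi; split.
  by rewrite -(ltr_pM2r SR0) mulrAC; exact: le_lt_trans glo fhi.
rewrite -(ler_pM2r SR0) mulrDl /eps divfK ?gt_eqF// mulrAC.
exact: le_trans flo ghi.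
Qed.

End Power.

(** If [[n, f n[] lay in the image of [f], its points would be values at [f n - n] consecutive
    arguments starting at some [c] with [f c = n], all below [n]. So [c + f n <= 2 n]; with
    [c ~ n / gamma] and [f n ~ gamma n] this fails for large [n], since [1 / gamma + gamma > 2]. *)
Lemma lcm_shift_growth : exists S, (0 < S)%N /\
  let f := lcm_shift (r ^ S) in
  {homo f : m n / (m < n)%N} /\
  exists n0, (0 < n0)%N /\ forall n, (n0 <= n)%N ->
    (n < f n)%N /\ exists y, [/\ (n <= y)%N, (y < f n)%N & forall c, f c <> y].
Proof.
have g1 := gamma_gt1.
(* This gives [eps <= gamma - 1], so that [f n <= n gamma + eps <= (n + 1) gamma - 1 < f (n +
   1)]. *)
pose S := (Num.truncn (lns / (lnr * (gamma - 1)))).+1.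
exists S; split=> // f.
pose eps : R := lns / (S%:R * lnr).
have fB n : n%:R * gamma < (f n).+1%:R /\ (f n)%:R <= n%:R * gamma + eps.
  exact: lcm_shift_bounds.
have epsB : eps <= gamma - 1.
  have := truncnS_gt (lns / (lnr * (gamma - 1))); rewrite -/S.
  have ? : 0 < gamma - 1 by rewrite subr_gt0.
  rewrite ltr_pdivrMr ?mulr_gt0// => /ltW h.
  by rewrite ler_pdivrMr ?mulr_gt0 ?ltr0n//; apply: le_trans h _; rewrite le_eqVlt mulrA [X in X == _]mulrC eqxx.
have eps0 : 0 <= eps by rewrite divr_ge0 ?mulr_ge0 ?ltW.
have fS n : (f n < f n.+1)%N.
  rewrite -ltnS -(ltr_nat R).
  have [h1 _] := fB n.+1; have [_ h2] := fB n; apply: le_lt_trans h1.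
  by rewrite -natr1 -(natr1 n) mulrDl mul1r; move: h2 epsB; lra.
have f_homo : {homo f : m n / (m < n)%N}.
  by apply: homo_ltn => //; exact: ltn_trans.
split => //.
(* The second summand gives [n (gamma - 1) >= 1], hence [f n > n]; the first gives the inequality
   that the final count contradicts. *)
pose n0 := (Num.truncn ((gamma + eps) / (gamma - 1) ^+ 2 + 1 / (gamma - 1))).+1.
exists n0; split => // n n0n.
have g0 : 0 < gamma - 1 by rewrite subr_gt0.
have B0 : 0 <= (gamma + eps) / (gamma - 1) ^+ 2.
  by rewrite divr_ge0 ?sqr_ge0//; move: g1 eps0; lra.
have nB : (gamma + eps) / (gamma - 1) ^+ 2 + 1 / (gamma - 1) <= n%:R.
  by apply: (le_trans (ltW (truncnS_gt _))); rewrite ler_nat.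
have nB1 : 1 <= n%:R * (gamma - 1) by rewrite -ler_pdivrMr//; move: nB B0; lra.
have nB2 : gamma + eps <= n%:R * (gamma - 1) ^+ 2.
  rewrite -ler_pdivrMr ?exprn_gt0//; apply: le_trans nB; rewrite lerDl divr_ge0// ltW//.
have nf : (n < f n)%N.
  rewrite -ltnS -(ltr_nat R); have [h1 _] := fB n; apply: le_lt_trans h1.
  by rewrite -natr1; move: nB1; lra.
split => //; apply: contrapT => nex.
have im y : (n <= y)%N -> (y < f n)%N -> exists c, f c = y.
  move=> ny yf; apply: contrapT => nc; apply: nex; exists y; split=> // c fc.
  by apply: nc; exists c.
have [c fc] := im n (leqnn n) nf.
have f_lt a b : (f a < f b)%N -> (a < b)%N.
  by rewrite !ltnNge; apply: contra; rewrite leq_eqVlt => /predU1P[->//|/f_homo/ltnW].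
(* Consecutive numbers in the image of an increasing [f] are its values at consecutive arguments. *)
have tel t : (n + t < f n)%N -> f (c + t)%N = (n + t)%N.
  elim: t => [|t IH] tl; first by rewrite !addn0.
  have {}IH : f (c + t)%N = (n + t)%N by apply: IH; apply: ltn_trans tl; rewrite addnS.
  have [d fd] := im (n + t.+1)%N (leq_addr _ _) tl.
  have cd : (c + t < d)%N by apply: f_lt; rewrite IH fd addnS.
  apply/eqP; rewrite eqn_leq -{1}fd; apply/andP; split.
    by rewrite addnS; move: cd; rewrite leq_eqVlt => /predU1P[<-//|/f_homo/ltnW].
  by rewrite !addnS -IH; exact: fS.
pose L := (f n - n).-1.
have nL : (n + L.+1 = f n)%N by rewrite prednK ?subn_gt0// subnKC// ltnW.
have cn : (c + L < n)%N by apply: f_lt; rewrite tel -nL addnS.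
have cnR : c%:R + (f n)%:R + 1 <= n%:R + n%:R + 1 :> R.
  by rewrite -!natrD -!(natrD _ _ 1) ler_nat; nlia.
have [h1 _] := fB n; have [_ h2] := fB c.
move: h1 h2; rewrite fc -natr1 => h1 h2.
have c_lo : (n%:R - eps) <= c%:R * gamma by move: h2; lra.
have c_hi : c%:R < 2 * n%:R - n%:R * gamma + 1 by move: cnR h1; lra.
have {}c_hi : c%:R * gamma < (2 * n%:R - n%:R * gamma + 1) * gamma.
  by rewrite ltr_pM2r// (lt_trans ltr01).
by move: c_lo c_hi nB2; rewrite expr2; lra.
Qed.

End Growth.

(** * Changing the base, the shift, and digits *)

Lemma cantor_set_base (R : realType) (P Q : set R) (r : nat) (K : {set 'I_r}) :
  (3 <= r)%N -> (forall k : 'I_r, k \in K -> (1 <= k <= r - 2)%N) ->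
  (exists k : 'I_r, k \in K) -> dset1 P Q (@cantor_set R r K) ->
  dset1 P Q (is_npow r) /\ dset2 P Q (is_mult r).
Proof.
move=> r3 hK hK0 dC; have [i [l [l0 run rmax]]] := max_run hK hK0.
have Ci := @cantor_set_itv R r K.
have C0 := @cantor_set0 R r K r3 hK.
have C1 := @cantor_set1 R r K r3 hK.
have Cc := cantor_set_cons r3 hK.
have Cu := cantor_set_uncons r3 hK.
split.
- exact: (dset1_is_npow0 r3 hK Ci C0 C1 (Cc R) (Cu R) dC l0 run rmax).
- exact: (dset2_is_mult0 r3 hK Ci C0 C1 (Cc R) (Cu R) dC l0 run rmax).
Qed.

(** * From base [r] to base [r ^ S] *)

Section PowerBase.
Variables (R : realType) (P Q : set R) (r S : nat).
Hypothesis r3 : (3 <= r)%N.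
Hypothesis S_gt0 : (0 < S)%N.
Hypothesis dA : dset1 P Q (is_npow r).
Hypothesis dM : dset2 P Q (is_mult r).
Let rho := (r ^ S)%N.
Let rho_ge3 : (3 <= rho)%N.
Proof. by apply: leq_trans r3 _; rewrite -{1}(expn1 r) leq_exp2l//; lia. Qed.

Lemma npow_exp n : npow rho n = npow r (S * n) :> R.
Proof. by rewrite /npow natrX exprM. Qed.

(** Modulo [rho - 1], [r ^ n] is [r ^ t] with [t = n %% S]; for [0 < t] the number [r ^ t - 1] is
    positive and below [rho - 1]. *)
Lemma dvdn_pred_exp n : (rho.-1 %| (r ^ n).-1)%N -> (S %| n)%N.
Proof.
move=> d; have t_lt : (n %% S < S)%N by exact: ltn_pmod.
have r0 : (0 < r)%N by lia.
have d1 : (rho.-1 %| (rho ^ (n %/ S)).-1)%N by rewrite predn_exp dvdn_mulr.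
have E : ((r ^ n).-1 = (rho ^ (n %/ S)).-1 * r ^ (n %% S) + (r ^ (n %% S)).-1)%N.
  rewrite {1}(divn_eq n S) expnD [(_ * S)%N]mulnC expnM -/rho.
  have : (0 < rho ^ (n %/ S))%N by rewrite expn_gt0; lia.
  have : (0 < r ^ (n %% S))%N by rewrite expn_gt0 r0.
  move: (rho ^ _)%N (r ^ _)%N => [|x] [|y]// _ _.
  by rewrite mulSn addSn /= addnC.
move: d; rewrite E dvdn_addr ?dvdn_mulr// => d.
have [t0|t0] := posnP (n %% S)%N; first by rewrite /dvdn t0.
have lt1 : (r ^ (n %% S) < rho)%N by rewrite ltn_exp2l//; lia.
have gt1 : (1 < r ^ (n %% S))%N by rewrite -(expn0 r) ltn_exp2l//; lia.
have aux x y : (y.-1 %| x.-1)%N -> (x < y)%N -> (1 < x)%N -> False.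
  by move=> /dvdn_leq h xy x1; clear -h xy x1; lia.
by case: (aux _ _ d lt1 gt1).
Qed.

(** The second condition says that [rho - 1] divides [r ^ n - 1], that is, [S] divides [n]. *)
Lemma is_npow_exp (a : R) : is_npow rho a <->
  is_npow r a /\ exists m, is_mult r a m /\ (rho - 1)%:R * m + a = 1.
Proof.
have r0 : (0 < r)%N by lia.
have rR : (r%:R : R) != 0 by rewrite pnatr_eq0 -lt0n.
split=> [[n [n0 ->]]|[[n [n0 ->]] [m [[n' [e [n'0 nE -> m1]]] E]]]].
  rewrite npow_exp; have Sn0 : (0 < S * n)%N by rewrite muln_gt0 S_gt0.
  split; first by exists (S * n)%N.
  pose e := (\sum_(i < n) rho ^ i)%N.
  have eE : ((rho - 1) * e + 1 = r ^ (S * n))%N.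
    by rewrite subn1 -predn_exp addn1 prednK ?expnM// expn_gt0; lia.
  have {}eE : (rho - 1)%:R * e%:R + 1 = r%:R ^+ (S * n) :> R.
    by rewrite -natrM natr1 -addn1 eE natrX.
  have E : (rho - 1)%:R * (e%:R * npow r (S * n)) + npow r (S * n) = 1 :> R.
    rewrite mulrA -[X in _ + X]mul1r -mulrDl eE /npow divff//.
    by rewrite expf_neq0.
  exists (e%:R * npow r (S * n)); split=> //; exists (S * n)%N, e; split => //.
  have p0 := npow_gt0 R (S * n) r0.
  have : 1 <= (rho - 1)%:R :> R by rewrite ler1n; lia.
  have : 0 <= e%:R * npow r (S * n) :> R by rewrite mulr_ge0// ltW.
  move: E p0; move: (e%:R * npow r (S * n) : R) (npow r (S * n) : R) ((rho - 1)%:R : R).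
  by move=> x y z; nra.
have {}E : ((rho - 1) * e + 1 = r ^ n)%N.
  apply/eqP; rewrite -(eqr_nat R) natrD natrM natrX; apply/eqP.
  move: E; rewrite mulrA -[X in _ + X]mul1r -mulrDl /npow => /eqP.
  by rewrite -[X in _ == X](@divff _ (r%:R ^+ n)) ?expf_neq0// => /eqP/mulIf->//; rewrite invr_eq0 expf_neq0.
have /dvdnP[q qE] : (S %| n)%N.
  by apply: dvdn_pred_exp; rewrite -E addn1 /= subn1 dvdn_mulr.
exists q; split; first by move: n0; rewrite qE muln_gt0 => /andP[].
by rewrite npow_exp mulnC qE.
Qed.

Lemma is_mult_exp (a x : R) : is_mult rho a x <-> is_npow rho a /\ is_mult r a x.
Proof.
split=> [[n [e [n0 aE xE x1]]]|[[n [n0 aE]] [_ [e [_ _ xE x1]]]]].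
  split; first by exists n.
  by exists (S * n)%N, e; rewrite -npow_exp muln_gt0 S_gt0.
by exists n, e.
Qed.

Lemma dset1_npow_exp : dset1 P Q (is_npow rho).
Proof.
move=> t dt; apply: (@dpred_ext _ _ _ (fun e => is_npow r (t e) /\
  exists m, is_mult r (t e) m /\ (rho - 1)%:R * m + t e = 1)); last by dsolve.
by move=> e; rewrite is_npow_exp.
Qed.

Lemma dset2_mult_exp : dset2 P Q (is_mult rho).
Proof.
have dN := dset1_npow_exp => t u dt du.
apply: (@dpred_ext _ _ _ (fun e => is_npow rho (t e) /\ is_mult r (t e) (u e))).
  by move=> e; rewrite is_mult_exp.
by dsolve.
Qed.

End PowerBase.

(** * Defining the shift [f] on exponents *)

Section Shift.
Variables (R : realType) (P Q : set R) (rho s : nat).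
Hypothesis rho3 : (3 <= rho)%N.
Hypothesis s2 : (2 <= s)%N.
Hypothesis dA : dset1 P Q (is_npow rho).
Hypothesis dM : dset2 P Q (is_mult rho).
Hypothesis dB : dset1 P Q (is_npow s).
Hypothesis dN : dset2 P Q (is_mult s).

Let rho0 : (0 < rho)%N. Proof. lia. Qed.
Let rho1 : (1 < rho)%N. Proof. lia. Qed.
Let s0 : (0 < s)%N. Proof. lia. Qed.

Definition min_dist (a b d : R) :=
  0 < d /\ (exists x y, is_mult rho a x /\ is_mult s b y /\ y - x = d) /\
  forall x y, is_mult rho a x -> is_mult s b y -> x < y -> d <= y - x.

(** Over the common denominator [l], the two kinds of multiples have numerators divisible by [B']
    and by [A'], which are coprime; the difference [1 / l] is attained by Bezout. *)
Lemma min_distP n m (d : R) : (0 < n)%N -> (0 < m)%N ->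
  min_dist (npow rho n) (npow s m) d <-> d = (lcmn (rho ^ n) (s ^ m))%:R^-1.
Proof.
move=> n0 m0; set A := (rho ^ n)%N; set B := (s ^ m)%N.
have A0 : (0 < A)%N by rewrite expn_gt0 rho0.
have B0 : (0 < B)%N by rewrite expn_gt0 s0.
set l := lcmn A B; have l0 : (0 < l)%N by rewrite lcmn_gt0 A0.
pose g := gcdn A B; have g0 : (0 < g)%N by rewrite gcdn_gt0 A0.
pose A' := (A %/ g)%N; pose B' := (B %/ g)%N.
have AE : A = (A' * g)%N by rewrite divnK// dvdn_gcdl.
have BE : B = (B' * g)%N by rewrite divnK// dvdn_gcdr.
have A'0 : (0 < A')%N by move: A0; rewrite AE muln_gt0 => /andP[].
have B'0 : (0 < B')%N by move: B0; rewrite BE muln_gt0 => /andP[].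
have lE : (l = A' * B' * g)%N.
  by apply/eqP; rewrite -(eqn_pmul2r g0) muln_lcm_gcd {1}AE BE; apply/eqP; nia.
have cop : gcdn A' B' = 1%N.
  by apply/eqP; rewrite -(eqn_pmul2r g0) muln_gcdl -AE -BE mul1n.
have gR : (g%:R : R) != 0 by rewrite pnatr_eq0 -lt0n.
have A'R : (A'%:R : R) != 0 by rewrite pnatr_eq0 -lt0n.
have B'R : (B'%:R : R) != 0 by rewrite pnatr_eq0 -lt0n.
have xE (e : nat) : e%:R * npow rho n = (e * B')%:R / l%:R :> R.
  by rewrite /npow -natrX -/A lE AE !natrM; field; rewrite A'R B'R gR.
have yE (e : nat) : e%:R * npow s m = (e * A')%:R / l%:R :> R.
  by rewrite /npow -natrX -/B lE BE !natrM; field; rewrite A'R B'R gR.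
have lR0 : 0 < l%:R :> R by rewrite ltr0n.
have low (x y : R) : is_mult rho (npow rho n) x -> is_mult s (npow s m) y -> x < y ->
    l%:R^-1 <= y - x.
  move=> [_ [e [_ _ -> _]]] [_ [e' [_ _ -> _]]]; rewrite xE yE ltr_pM2r ?invr_gt0//.
  rewrite ltr_nat => h; rewrite -mulrBl -natrB; last exact: ltnW.
  by apply: ler_peMl; rewrite ?invr_ge0 ?ler0n// ler1n subn_gt0.
have [x [y [mx my xy]]] : exists x y : R, [/\ is_mult rho (npow rho n) x,
    is_mult s (npow s m) y & y - x = l%:R^-1].
  have [a aA] := Bezoutl B' A'0; rewrite cop => /dvdnP[e eE].
  have eB : (e <= B')%N.
    have : (e * A' <= B' * A')%N by rewrite -eE add1n; move: aA B'0; clear; nia.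
    by rewrite leq_pmul2r.
  have aR : (a%:R * npow rho n <= 1 :> R).
    rewrite /npow ler_pdivrMr ?exprn_gt0 ?ltr0n// mul1r -natrX ler_nat -/A AE.
    by apply: leq_trans (ltnW aA) _; rewrite leq_pmulr.
  have eR : (e%:R * npow s m <= 1 :> R).
    rewrite /npow ler_pdivrMr ?exprn_gt0 ?ltr0n// mul1r -natrX ler_nat -/B BE.
    by apply: leq_trans eB _; rewrite leq_pmulr.
  exists (a%:R * npow rho n), (e%:R * npow s m); split; [by exists n, a|by exists m, e|].
  by rewrite xE yE -mulrBl -eE natrD addrK mul1r.
split=> [[d0 [[x' [y' [mx' [my' dE]]]] dlow]]|->].
  apply/eqP; rewrite eq_le; apply/andP; split.
    by rewrite -xy; apply: dlow => //; rewrite -subr_gt0 xy invr_gt0.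
  by rewrite -dE; apply: low => //; rewrite -subr_gt0 dE.
split; first by rewrite invr_gt0.
by split; [exists x, y|].
Qed.

(** For [a = rho^-n], the bounds on [b] select the least power of [s] not below [rho ^ n], [d] is
    the reciprocal of the lcm, and the bounds on [a'] truncate its logarithm. *)
Definition shift_graph (a a' : R) :=
  is_npow rho a /\ is_npow rho a' /\ exists b, is_npow s b /\ b <= a /\ a < s%:R * b /\
  exists d, min_dist a b d /\ d <= a' /\ a' < rho%:R * d.

Lemma lcm_shift_ge n : (n <= lcm_shift s rho n)%N.
Proof.
apply: trunc_log_max => //; apply: dvdn_leq; last exact: dvdn_lcml.
by rewrite lcmn_gt0 !expn_gt0 rho0 s0.
Qed.

Lemma shift_graphP n x : (0 < n)%N ->
  shift_graph (npow rho n) x <-> x = npow rho (lcm_shift s rho n).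
Proof.
move=> n0.
have le_np (p q u v : nat) : (0 < p)%N -> (0 < q)%N ->
    (npow p u <= npow q v :> R) = (q ^ v <= p ^ u)%N.
  by move=> p0 q0; rewrite lef_pV2 ?posrE ?exprn_gt0 ?ltr0n// -!natrX ler_nat.
have npS (p u : nat) : (0 < p)%N -> p%:R * npow p u.+1 = npow p u :> R by exact: npowS.
have fE : (rho ^ lcm_shift s rho n <= lcmn (rho ^ n) (s ^ up_log s (rho ^ n))
      < rho ^ (lcm_shift s rho n).+1)%N.
  by apply: trunc_log_bounds => //; rewrite lcmn_gt0 !expn_gt0 rho0 s0.
have rn1 : (1 < rho ^ n)%N by rewrite -(expn0 rho) ltn_exp2l.
have lVE (l k : nat) : (0 < l)%N ->
    ((l%:R^-1 <= npow rho k :> R) = (rho ^ k <= l)%N) *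
    ((npow rho k < rho%:R * l%:R^-1 :> R) = (l < rho ^ k.+1)%N).
  move=> l0; split; first by rewrite lef_pV2 ?posrE ?exprn_gt0 ?ltr0n// -!natrX ler_nat.
  rewrite ltr_pdivlMr ?ltr0n// mulrC /npow ltr_pdivrMr ?exprn_gt0 ?ltr0n//.
  by rewrite -exprS -natrX ltr_nat.
have l0 m : (0 < lcmn (rho ^ n) (s ^ m))%N by rewrite lcmn_gt0 !expn_gt0 rho0 s0.
split=> [[_ [[k [k0 ->]] [_ [[m [m0 ->]] [ba [ab [d [/min_distP-/(_ n0 m0)->]]]]]]]]|->].
  rewrite !lVE// => -[kl lk].
  suff mE : m = up_log s (rho ^ n) by rewrite /lcm_shift -mE (@trunc_log_eq _ k) ?kl.
  case: m m0 ba ab {kl lk} => // m _; rewrite npS// le_np// ltNge le_np// -ltnNge.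
  by move=> hi lo; rewrite (@up_log_eq _ m)// lo.
split; first by exists n.
split; first by exists (lcm_shift s rho n); rewrite (leq_trans n0 (lcm_shift_ge n)).
have m0 : (0 < up_log s (rho ^ n))%N by rewrite up_log_gt0 s2.
have /andP[lo hi] := up_log_bounds s2 rn1.
exists (npow s (up_log s (rho ^ n))); split; first by exists (up_log s (rho ^ n)).
rewrite le_np// hi; split=> //; split.
  by rewrite -(prednK m0) npS// ltNge le_np// -ltnNge.
exists (lcmn (rho ^ n) (s ^ up_log s (rho ^ n)))%:R^-1; split; first exact/min_distP.
by rewrite !lVE//; case/andP: fE.
Qed.

Lemma dset2_shift_graph : dset2 P Q shift_graph.
Proof.
have dD : dset3 P Q min_dist by rewrite /min_dist; dsolve.
by rewrite /shift_graph; dsolve.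
Qed.

End Shift.

(** * Base-[rho] digits and the coding of sets of exponents by reals *)

Section Digits.
Variables (R : realType) (P Q : set R) (rho : nat).
Hypothesis rho3 : (3 <= rho)%N.

Let rho0 : (0 < rho)%N. Proof. exact: ltnW (ltnW rho3). Qed.
Let rho1 : (1 < rho)%N. Proof. exact: ltnW. Qed.

(** The multiple of [rho * a] is written [rho * q] with [q] a multiple of [a], because for
    [a = rho^-1] the predicate [is_mult] does not apply to [rho * a = 1]. *)
Definition has_digit (d : nat) (a y : R) :=
  exists q, is_mult rho a q /\ rho%:R * q + d%:R * a <= y /\ y < rho%:R * q + d.+1%:R * a.

Lemma dset2_has_digit d : dset2 P Q (is_mult rho) -> dset2 P Q (has_digit d).
Proof. by move=> dM; rewrite /has_digit; dsolve. Qed.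

Lemma has_digitP d n y : (0 < n)%N -> (d < rho)%N -> 0 <= y <= 1 ->
  has_digit d (npow rho n) y <-> (Num.truncn (y * rho%:R ^+ n) %% rho)%N = d.
Proof.
move=> n0 dr /andP[y0 y1].
have X0 : 0 < rho%:R ^+ n :> R by rewrite exprn_gt0// ltr0n.
have E (e c : nat) : rho%:R * (e%:R * npow rho n) + c%:R * npow rho n =
    (e * rho + c)%:R / rho%:R ^+ n :> R.
  by rewrite /npow natrD natrM; ring.
split=> [[_ [[_ [e [_ _ -> _]]]]]|<-].
  rewrite !E ler_pdivrMr// ltr_pdivlMr// addnS => -[lo hi].
  by rewrite (@truncn_def _ _ (e * rho + d)) ?lo// modnMDl modn_small.
have yX : 0 <= y * rho%:R ^+ n by rewrite mulr_ge0// ltW.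
have /andP[lo hi] := truncn_itv yX; set w := Num.truncn _ in lo hi *.
exists ((w %/ rho)%:R * npow rho n); split.
  exists n, (w %/ rho)%N; split => //.
  rewrite /npow ler_pdivrMr// mul1r; apply: (@le_trans _ _ w%:R).
    by rewrite ler_nat leq_div.
  by apply: le_trans lo _; rewrite ler_piMl// ltW.
by rewrite !E ler_pdivrMr// ltr_pdivlMr// addnS -divn_eq.
Qed.

(** [z] has digit 1 at the places in [Z] and 0 elsewhere; it is the supremum of its truncations
    [u n]. *)
Lemma has_digit_code (Z : nat -> Prop) :
  exists z, forall n, (0 < n)%N -> has_digit 1 (npow rho n) z <-> Z n.
Proof.
pose c n : nat := `[< Z n >].
pose w := fix w n : nat := if n is m.+1 then (w m * rho + c m.+1)%N else 0%N.
(* [h] is the number with all digits 1, the largest possible tail. As [rho >= 3], it is below 1, so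
   [w n] is the integer part of [z rho^n]. *)
pose h : R := (rho%:R - 1)^-1.
have rR : 3 <= rho%:R :> R by rewrite ler_nat.
have h0 : 0 < h by rewrite invr_gt0; lra.
have hE : h * rho%:R = 1 + h.
  have : h * (rho%:R - 1) = 1 by rewrite mulVf// gt_eqF//; lra.
  lra.
pose u n : R := (w n)%:R * npow rho n; pose v n : R := ((w n)%:R + h) * npow rho n.
have c1 n : (c n)%:R <= 1 :> R by rewrite lern1 leq_b1.
have uS n : u n <= u n.+1.
  rewrite /u /= natrD natrM mulrDl -mulrA npowS// lerDl mulr_ge0// ltW//.
  exact: npow_gt0.
have vS n : v n.+1 <= v n.
  rewrite /v -(npowS R n rho0) /= natrD natrM mulrA ler_pM2r ?npow_gt0//.
  by have := c1 n.+1; rewrite mulrDl hE; lra.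
have uv n : u n <= v n by rewrite ler_pM2r ?npow_gt0// lerDl ltW.
have u_mono : {homo u : m n / (m <= n)%N >-> m <= n}.
  by apply: homo_leq => //; exact: le_trans.
have v_mono : {homo v : m n / (m <= n)%N >-> n <= m}.
  by apply: homo_leq => // x y z xy yz; exact: le_trans yz xy.
have uv2 m n : u m <= v n.
  have [mn|/ltnW nm] := leqP m n; first exact: le_trans (u_mono _ _ mn) (uv n).
  exact: le_trans (uv m) (v_mono _ _ nm).
pose z := sup (range u).
have hsup : has_sup (range u).
  split; first by exists (u 0%N), 0%N.
  by exists (v 0%N) => _ [m _ <-].
have uz n : u n <= z by apply: sup_upper_bound => //; exists n.
have zv n : z <= v n by apply: ge_sup => [|_ [m _ <-]//]; exact: (proj1 hsup).
exists z => n n0.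
have z0 : 0 <= z by apply: le_trans (uz 0%N); rewrite /u mul0r.
have h1 : h < 1 by rewrite invf_lt1; lra.
have z1 : z <= 1.
  by apply: le_trans (zv 0%N) _; rewrite /v /= add0r /npow expr0 invr1 mulr1 ltW.
have tE : Num.truncn (z * rho%:R ^+ n) = w n.
  have X0 : 0 < rho%:R ^+ n :> R by rewrite exprn_gt0// ltr0n.
  apply: truncn_def; rewrite -ler_pdivrMr// uz /=.
  rewrite -ltr_pdivlMr//; apply: le_lt_trans (zv n) _.
  by rewrite ltr_pM2r ?npow_gt0// -natr1 ltrD2l.
rewrite has_digitP ?z0// tE; case: n n0 {tE} => // n _ /=.
rewrite modnMDl /c modn_small; last by case: `[< _ >].
by case: (asboolP (Z n.+1)).
Qed.

End Digits.

(** * Coding binary relations *)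

Section Rows.
Variables (f : nat -> nat) (n0 : nat).
Hypothesis f_homo : {homo f : m n / (m < n)%N}.
Hypothesis f_gt : forall n, (n0 <= n)%N -> (n < f n)%N.

Definition reach (m n : nat) := exists k, n = iter k f m.
Definition start (y : nat) := forall c, f c <> y.
Definition row (i : nat) := iter i f n0.

Lemma f_lt m n : (f m < f n)%N -> (m < n)%N.
Proof.
by rewrite !ltnNge; apply: contra; rewrite leq_eqVlt => /predU1P[->//|/f_homo/ltnW].
Qed.

Lemma f_leq m n : (m <= n)%N -> (f m <= f n)%N.
Proof. by rewrite leq_eqVlt => /predU1P[->//|/f_homo/ltnW]. Qed.

Lemma f_inj : injective f.
Proof.
by move=> m n E; case: (ltngtP m n) => // /f_homo; rewrite E ltnn.
Qed.

Lemma iter_ge k x : (n0 <= x)%N -> (x <= iter k f x)%N.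
Proof.
move=> x0; elim: k => //= k IH; apply: (leq_trans IH); apply/ltnW/f_gt.
exact: leq_trans x0 IH.
Qed.

Lemma row_lt i j : (i < j)%N -> (row i < row j)%N.
Proof.
have rS k : (row k < row k.+1)%N by apply: f_gt; exact: iter_ge.
suff h : {homo row : i j / (i < j)%N} by exact: h.
by apply: homo_ltn => //; exact: ltn_trans.
Qed.

Lemma row_leq i j : (i <= j)%N -> (row i <= row j)%N.
Proof. by rewrite leq_eqVlt => /predU1P[->//|/row_lt/ltnW]. Qed.

Lemma row_ge i : (i <= row i)%N.
Proof. by elim: i => // i IH; apply: leq_ltn_trans IH (row_lt _). Qed.

Lemma row_gen i : (n0 <= row i)%N.
Proof. exact: iter_ge. Qed.

Lemma row_inj : injective row.
Proof. by move=> i j E; case: (ltngtP i j) => // /row_lt; rewrite E ltnn. Qed.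

Lemma row_uniq i j x : (row i <= x < row i.+1)%N -> (row j <= x < row j.+1)%N -> i = j.
Proof.
move=> /andP[a b] /andP[c d]; case: (ltngtP i j) => // /row_leq h.
  by have := leq_ltn_trans (leq_trans h c) b; rewrite ltnn.
by have := leq_ltn_trans (leq_trans h a) d; rewrite ltnn.
Qed.

(** [f] maps each row into the next, so an orbit that begins before the end of row [i] meets that
    row. *)
Lemma reach_row x i : (n0 <= x)%N -> (x < row i.+1)%N ->
  exists y, reach x y /\ (row i <= y < row i.+1)%N.
Proof.
move=> x0; elim: i => [|i IH] xi; first by exists x; split; [exists 0%N|rewrite x0].
have [xr|xr] := leqP (row i.+1) x; first by exists x; split; [exists 0%N|rewrite xr].
have [_ [[k ->] /andP[a b]]] := IH xr.
by exists (iter k.+1 f x); split; [exists k.+1|rewrite [iter _ _ _]/= f_leq// f_homo].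
Qed.

(** As [f] is injective, the two iterations can be undone together until one of them is
    exhausted. *)
Lemma reach_comparable a b x : reach a x -> reach b x -> reach a b \/ reach b a.
Proof.
move=> [k ->] [m]; elim: k m => [|k IH] [|m] /=.
- by move=> ->; left; exists 0%N.
- by move=> ->; right; exists m.+1.
- by move=> <-; left; exists k.+1.
- by move=> /f_inj/IH.
Qed.

Lemma reach_start a y : start y -> reach a y -> a = y.
Proof. by move=> sy [[|k] yE//]; case: (sy (iter k f a)). Qed.

Lemma start_uniq y y' x : start y -> start y' -> reach y x -> reach y' x -> y = y'.
Proof.
move=> sy sy' r r'; case: (reach_comparable r r') => h; first exact: reach_start h.
by apply/esym; exact: reach_start h.
Qed.

Lemma reach_window a b y : (n0 <= a)%N -> reach a b -> (y < f a)%N -> (b <= y)%N -> a = b.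
Proof.
move=> a0 [[|k] ->//] yf; rewrite iterSr => h.
have fa0 : (n0 <= f a)%N by exact: leq_trans a0 (ltnW (f_gt a0)).
by have := leq_ltn_trans (leq_trans (iter_ge k fa0) h) yf; rewrite ltnn.
Qed.

(* Row [i] records the number [a] by its orbit ([mark_orbit]) and, since the
   orbit alone does not determine [a], by the orbit of an [f]-free point of
   [[a, f a[] ([mark_start]). *)
Variable H : nat -> nat -> Prop.
Hypothesis H_fun : forall i a a', H i a -> H i a' -> a = a'.
Hypothesis H_bounds : forall i a, H i a -> (n0 <= a <= i)%N.
Hypothesis f_start : forall n, (n0 <= n)%N ->
  exists y, [/\ (n <= y)%N, (y < f n)%N & start y].

Definition mark_orbit x :=
  exists i a, [/\ H i a, reach a x & (row i <= x < row i.+1)%N].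
Definition mark_start x := exists i a y,
  [/\ H i a, start y, (a <= y < f a)%N, reach y x & (row i <= x < row i.+1)%N].

(** The marks found in row [i] come from the number [a'] recorded there. The point [p] puts [a] and
    [a'] on one orbit; [q] forces the two free points to coincide, so [[a, f a[] and [[a', f a'[]
    share [w], and [reach_window] gives [a = a']. *)
Lemma row_decode i a : H i a <-> (n0 <= a)%N /\
  (exists p, [/\ mark_orbit p, (row i <= p)%N, (p < f (row i))%N & reach a p]) /\
  exists q, [/\ mark_start q, (row i <= q)%N, (q < f (row i))%N &
    exists w, [/\ start w, (a <= w)%N, (w < f a)%N & reach w q]].
Proof.
split=> [Hia|[a0 [[p [[i' [a' [Hia' ra'p i'p]]] ip pi rap]]
    [q [[i'' [a'' [y [Hia'' sy /andP[ay ya] ryq i''q]]] iq qi [w [sw aw wa rwq]]]]]]]].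
  have /andP[a0 ai] := H_bounds Hia; split=> //.
  have [w [aw wa sw]] := f_start a0.
  (* Since [a <= i], the orbits of [a] and of [w] have begun before the end of row [i]. *)
  have ar : (a <= row i)%N by exact: leq_trans ai (row_ge i).
  have wr : (w < row i.+1)%N by apply: leq_trans wa _; exact: f_leq.
  have [p [rap pi]] := reach_row a0 (leq_ltn_trans ar (row_lt (ltnSn i))).
  have [q [rwq qi]] := reach_row (leq_trans a0 aw) wr.
  have [/andP[p1 p2] /andP[q1 q2]] := (pi, qi).
  split; first by exists p; split => //; exists i, a.
  exists q; split => //; last by exists w.
  by exists i, a, w; rewrite aw wa.
have ? : i' = i by apply: (@row_uniq _ _ p) => //; rewrite ip.
have ? : i'' = i by apply: (@row_uniq _ _ q) => //; rewrite iq.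
subst i' i''; have ? := H_fun Hia' Hia''; subst a''.
have ? := start_uniq sy sw ryq rwq; subst y.
have /andP[a'0 _] := H_bounds Hia'.
have [r|r] := reach_comparable rap ra'p.
  by rewrite (reach_window a0 r wa ay).
by rewrite -(reach_window a'0 r ya aw).
Qed.

End Rows.

(** * Definability of arbitrary binary relations on exponents *)

Section Grid.
Variables (R : realType) (P Q : set R) (rho : nat) (bit F : R -> R -> Prop).
Variables (f : nat -> nat) (n0 : nat).
Hypothesis rho2 : (1 < rho)%N.
Hypothesis n0_gt0 : (0 < n0)%N.
Hypothesis f_homo : {homo f : m n / (m < n)%N}.
Hypothesis f_gt : forall n, (n0 <= n)%N -> (n < f n)%N.
Hypothesis f_start : forall n, (n0 <= n)%N ->
  exists y, [/\ (n <= y)%N, (y < f n)%N & start f y].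
Hypothesis f_pos : forall n, (0 < n)%N -> (0 < f n)%N.
Hypothesis bit_code : forall Z : nat -> Prop,
  exists z, forall n, (0 < n)%N -> bit (npow rho n) z <-> Z n.
Hypothesis F_npow : forall x y, F x y -> is_npow rho x.
Hypothesis FP : forall n x, (0 < n)%N -> F (npow rho n) x <-> x = npow rho (f n).
Hypothesis dA : dset1 P Q (is_npow rho).
Hypothesis dbit : dset2 P Q bit.
Hypothesis dF : dset2 P Q F.

Local Notation el := (@npow R rho).

Definition code1 (Z : nat -> Prop) (x : R) :=
  exists n, [/\ (0 < n)%N, x = el n & Z n].
Definition code2 (V : nat -> nat -> Prop) (x y : R) :=
  exists m n, [/\ (0 < m)%N, (0 < n)%N, x = el m, y = el n & V m n].

Lemma dset1_code1 Z : dset1 P Q (code1 Z).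
Proof.
have [z zP] := bit_code Z => t dt.
apply: (@dpred_ext _ _ _ (fun e => is_npow rho (t e) /\ bit (t e) z)); last by dsolve.
move=> e; split=> [[[n [p ->]]] /zP Zn|[n [p -> /zP Zn]]].
  by exists n; split => //; exact: Zn.
by split; [exists n|exact: Zn].
Qed.

(** Reachability is membership in every [f]-closed set of exponents containing [m]; the quantifier
    over sets becomes one over the reals [z] coding them, the orbit of [m] being among these
    sets. *)
Lemma dset2_reach : dset2 P Q (code2 (reach f)).
Proof.
move=> t u dt du.
apply: (@dpred_ext _ _ _ (fun e => is_npow rho (t e) /\ is_npow rho (u e) /\
  forall z, bit (t e) z -> (forall x y, F x y -> bit x z -> bit y z) -> bit (u e) z));
  last by dsolve.
move=> e; split=> [[[m [m0 tE]] [[n [p uE]] H]]|[m [n [m0 p -> -> [k nE]]]]].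
  exists m, n; split => //; have [z zP] := bit_code (reach f m).
  move: H => /(_ z); rewrite tE uE zP// zP//; apply; first by exists 0%N.
  move=> x y Fxy; have [j [j0 xE]] := F_npow Fxy; move: Fxy; rewrite xE FP// => ->.
  by rewrite zP// zP ?f_pos// => -[i ->]; exists i.+1.
split; first by exists m.
split; first by exists n.
move=> z bm bS; rewrite nE {p nE}.
suff [] : (0 < iter k f m)%N /\ bit (el (iter k f m)) z by [].
elim: k => // k [p b]; split; first exact: f_pos.
by apply: bS b; exact/FP.
Qed.

Lemma dset2_row (H : nat -> nat -> Prop) :
  (forall i a a', H i a -> H i a' -> a = a') -> (forall i a, H i a -> (n0 <= a <= i)%N) ->
  dset2 P Q (fun x y => exists i a, [/\ x = el (row f n0 i), y = el a & H i a]).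
Proof.
move=> H_fun H_bounds.
have dec := row_decode f_homo f_gt H_fun H_bounds f_start.
have dO := dset1_code1 (fun n => exists i, n = row f n0 i).
have dZ1 := dset1_code1 (mark_orbit f n0 H).
have dZ2 := dset1_code1 (mark_start f n0 H).
have dY := dset1_code1 (start f).
have dR := dset2_reach.
have row0 i : (0 < row f n0 i)%N by apply: leq_trans n0_gt0 (row_gen _ _).
have leE m n : (el m <= el n) = (n <= m)%N by exact: ler_npow.
have ltE m n : (el m < el n) = (n < m)%N by exact: ltr_npow.
move=> t u dt du.
(* The criterion of [row_decode], with inequalities reversed because larger exponents give smaller
   reals. *)
apply: (@dpred_ext _ _ _ (fun e => code1 (fun n => exists i, n = row f n0 i) (t e) /\
  is_npow rho (u e) /\ u e <= el n0 /\ exists t', F (t e) t' /\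
  (exists p, code1 (mark_orbit f n0 H) p /\ p <= t e /\ t' < p /\ code2 (reach f) (u e) p) /\
  (exists q, code1 (mark_start f n0 H) q /\ q <= t e /\ t' < q /\
   exists w, code1 (start f) w /\ w <= u e /\ (exists u', F (u e) u' /\ u' < w) /\
   code2 (reach f) w q))); last by dsolve.
move=> e; split.
  move=> [[k [_ tE [i kE]]] [[a [a0 uE]] []]]; rewrite {}kE in tE.
  rewrite tE uE leE => na [t' []]; rewrite FP// => -> [].
  move=> [_ [[p [p0 -> mp]] [+ [+ [m1 [m2 [_ _ /npow_inj-/(_ rho2)<- /npow_inj-/(_ rho2)<- r1]]]]]]].
  rewrite leE ltE => p1 p2.
  move=> [_ [[q [q0 -> mq]] [+ [+]]]]; rewrite leE ltE => q1 q2.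
  move=> [_ [[w [w0 -> sw]] [+ [[u' []]]]]]; rewrite leE FP// => aw ->; rewrite ltE => wa.
  move=> [m3 [m4 [_ _ /npow_inj-/(_ rho2)<- /npow_inj-/(_ rho2)<- r2]]].
  exists i, a; split => //; apply/dec; split => //.
  by split; [exists p|exists q; split => //; exists w].
move=> [i [a [-> -> /dec[na [[p [mp p1 p2 r1]] [q [mq q1 q2 [w [sw aw wa r2]]]]]]]]].
have a0 : (0 < a)%N by exact: leq_trans n0_gt0 na.
have p0 := leq_trans (row0 i) p1; have q0 := leq_trans (row0 i) q1.
have w0 := leq_trans a0 aw.
split; first by exists (row f n0 i); split=> //; exists i.
split; first by exists a.
rewrite leE; split=> //; exists (el (f (row f n0 i))); split; first exact/FP.
split.
  exists (el p); rewrite leE ltE p1 p2; split; first by exists p.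
  by do 2 split => //; exists a, p.
exists (el q); rewrite leE ltE q1 q2; split; first by exists q.
do 2 split => //; exists (el w); split; first by exists w.
rewrite leE aw; split => //; split; last by exists w, q.
by exists (el (f a)); rewrite ltE wa; split => //; exact/FP.
Qed.

(** Injective because [a] is smaller than the distance from [(a + b)^2] to the next square; it also
    dominates [a] and [b], as a row can only record numbers up to its index. *)
Definition pair_index (a b : nat) : nat := ((a + b) * (a + b) + a)%N.

Lemma pair_index_inj a b a' b' : pair_index a b = pair_index a' b' -> a = a' /\ b = b'.
Proof.
rewrite /pair_index => E.
have S : (a + b = a' + b')%N.
  by case: (ltngtP (a + b) (a' + b')) => // h; move: E h; clear; nia.
by move: E; rewrite S => /addnI E; split=> //; move: S E; clear; lia.
Qed.

(** Row [pair_index a b] records [a] in one marking and [b] in another; [V] holds of [a] and [b]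
    when a single row records both. *)
Lemma dset2_code2 (V : nat -> nat -> Prop) :
  dset2 P Q (code2 (fun a b => (n0 <= a)%N /\ (n0 <= b)%N /\ V a b)).
Proof.
pose H1 i a := exists b, [/\ (n0 <= a)%N, (n0 <= b)%N, V a b & i = pair_index a b].
pose H2 i b := exists a, [/\ (n0 <= a)%N, (n0 <= b)%N, V a b & i = pair_index a b].
have d1 := @dset2_row H1; have d2 := @dset2_row H2.
have pi_ge a b : (a <= pair_index a b)%N /\ (b <= pair_index a b)%N.
  by rewrite /pair_index; clear; nia.
have {}d1 : dset2 P Q (fun x y => exists i a, [/\ x = el (row f n0 i), y = el a & H1 i a]).
  apply: d1 => [i a a' [b [_ _ _ ->]] [b' [_ _ _ /pair_index_inj[]]]//|].
  by move=> i a [b [-> _ _ ->]]; case: (pi_ge a b).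
have {}d2 : dset2 P Q (fun x y => exists i a, [/\ x = el (row f n0 i), y = el a & H2 i a]).
  apply: d2 => [i b b' [a [_ _ _ ->]] [a' [_ _ _ /pair_index_inj[]]]//|].
  by move=> i b [a [_ -> _ ->]]; case: (pi_ge a b).
move=> t u dt du.
apply: (@dpred_ext _ _ _ (fun e => exists o,
  (exists i a, [/\ o = el (row f n0 i), t e = el a & H1 i a]) /\
  (exists i a, [/\ o = el (row f n0 i), u e = el a & H2 i a]))); last first.
  apply: dpred_ex; cbv beta; apply: dpred_and; [apply: d1|apply: d2]; dsolve.
move=> e; split.
  move=> [_ [[i [a [-> -> [b [na nb Vab iE]]]]]] [j [b' [+ -> [a' [na' nb' Vab' jE]]]]]].
  move=> /npow_inj-/(_ rho2)/(row_inj f_gt) ij.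
  move: jE; rewrite -ij iE => /pair_index_inj[? ?]; subst a' b'.
  by exists a, b; split=> //; rewrite (leq_trans n0_gt0).
move=> [a [b [a0 b0 -> -> [na [nb Vab]]]]].
exists (el (row f n0 (pair_index a b))).
by split; [exists (pair_index a b), a|exists (pair_index a b), b]; split => //;
  [exists b|exists a].
Qed.

End Grid.

(** * Compact sets *)

Lemma truncn_divn (R : realType) (z : R) (c : nat) : 0 <= z -> (0 < c)%N ->
  Num.truncn (z / c%:R) = (Num.truncn z %/ c)%N.
Proof.
move=> z0 c0; have cR : 0 < c%:R :> R by rewrite ltr0n.
have /andP[lo hi] := truncn_itv z0; set t := Num.truncn z in lo hi *.
apply: truncn_def; rewrite ler_pdivlMr// ltr_pdivrMr// -!natrM; apply/andP; split.
  by apply: le_trans lo; rewrite ler_nat leq_trunc_div.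
by apply: lt_le_trans hi _; rewrite ler_nat -ltn_divLR.
Qed.

Lemma digits_inj (rho D a b : nat) : (0 < rho)%N -> (a < rho ^ D)%N -> (b < rho ^ D)%N ->
  (forall j, (j < D)%N -> (a %/ rho ^ j) %% rho = (b %/ rho ^ j) %% rho)%N -> a = b.
Proof.
move=> rho0; elim: D a b => [|D IH] a b.
  by rewrite expn0 !ltnS !leqn0 => /eqP-> /eqP->.
rewrite expnSr -!ltn_divLR// => aD bD dig.
have d0 := dig 0%N isT; rewrite expn0 !divn1 in d0.
rewrite (divn_eq a rho) (divn_eq b rho) d0 (IH _ _ aD bD)// => j jD.
by rewrite -!divnMA -expnS; exact: dig.
Qed.

Lemma compact_coord_bounded (R : realType) n (X : set 'rV[R]_n) : compact X ->
  exists B : nat, forall x, X x -> forall i, `|x ord0 i| <= B%:R.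
Proof.
move=> /compact_bounded[M [_ HM]].
exists (Num.truncn M).+2 => x Xx i.
have MB : M < (Num.truncn M).+2%:R.
  by apply: lt_trans (truncnS_gt M) _; rewrite ltr_nat.
apply: le_trans (HM _ MB x Xx).
rewrite /Num.norm /= mx_normrE.
exact: (le_bigmax _ (fun ij : 'I_1 * 'I_n => `|x ij.1 ij.2|) (ord0, i)).
Qed.

Lemma compact_coord_separated (R : realType) n (X : set 'rV[R]_n) x : compact X -> ~ X x ->
  exists2 eps : R, 0 < eps &
    forall y : 'rV[R]_n, (forall i, `|x ord0 i - y ord0 i| < eps) -> ~ X y.
Proof.
move=> /(compact_closed (@norm_hausdorff _ _))/closed_openC oX nX.
have /nbhs_ballP[eps /= eps0 sub] : nbhs x (~` X) by exact: open_nbhs_nbhs.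
exists eps => // y xy; apply: sub; split=> // i j; rewrite (ord1 i) /ball /=; exact: xy.
Qed.

Section Compact.
Variables (R : realType) (P Q : set R) (rho n0 : nat).
Hypothesis rho3 : (3 <= rho)%N.
Hypothesis n0_gt0 : (0 < n0)%N.
Hypothesis dd : forall d, dset2 P Q (has_digit rho d).
Hypothesis dV : forall V : nat -> nat -> Prop,
  dset2 P Q (code2 rho (fun a b => (n0 <= a)%N /\ (n0 <= b)%N /\ V a b)).

Variables (n : nat) (X : set 'rV[R]_n) (B : nat).
Hypothesis X_compact : compact X.
Hypothesis X_bounded : forall x, X x -> forall i, `|x ord0 i| <= B%:R.

Let rho0 : (0 < rho)%N. Proof. lia. Qed.
Let rho1 : (1 < rho)%N. Proof. lia. Qed.

Local Notation el := (@npow R rho).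
Local Notation scale := ((2 * B + 1) * rho ^ n0)%N.
Let scale_gt0 : 0 < scale%:R :> R.
Proof. by rewrite ltr0n muln_gt0 expn_gt0 rho0 addn1. Qed.

(* The chart [x |-> (x + B) / scale] sends [[-B, B]] into [[0, rho^-n0[], where
   the base-[rho] digits of index at most [n0] vanish. *)
Definition chart (x : R) : R := (x + B%:R) / scale%:R.

Lemma chartK x y : scale%:R * y = x + B%:R <-> y = chart x.
Proof.
rewrite /chart; split=> [<-|->]; first by rewrite [_ * y]mulrC mulfK// gt_eqF.
by rewrite mulrC divfK// gt_eqF.
Qed.

Lemma chart_itv x : `|x| <= B%:R -> 0 <= chart x < el n0.
Proof.
rewrite ler_norml => /andP[x1 x2]; have xB : 0 <= x + B%:R by lra.
rewrite divr_ge0 ?(ltW scale_gt0)//=.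
rewrite /npow ltr_pdivrMr// natrM natrX mulrC mulfK; last first.
  by rewrite expf_neq0// pnatr_eq0 -lt0n.
by rewrite natrD natrM; lra.
Qed.

Definition cell (w : {ffun 'I_n -> nat}) (m : nat) (x : 'rV[R]_n) :=
  forall i, Num.truncn (chart (x ord0 i) * rho%:R ^+ m) = w i.

Definition avoiding (w : {ffun 'I_n -> nat}) (m : nat) :=
  [/\ (n0 <= m)%N, forall i, (w i < rho ^ (m - n0))%N & forall x, cell w m x -> ~ X x].

(** The offset [n0] puts the index in the range where [dV] gives a definable relation. *)
Definition cell_index (w : {ffun 'I_n -> nat}) (m : nat) : nat := (n0 + pickle (w, m))%N.

Lemma cell_index_inj w m w' m' : cell_index w m = cell_index w' m' -> w = w' /\ m = m'.
Proof. by move=> /addnI/(pcan_inj pickleK)[]. Qed.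

(** A property of [j] in the shape of a binary relation, so that [dV] applies; it is read on the
    diagonal. *)
Definition valid_index (j _ : nat) := exists w m, avoiding w m /\ j = cell_index w m.

Definition cell_digit (i : 'I_n) (d : nat) (j k : nat) := exists w m,
  [/\ j = cell_index w m, (k <= m)%N & ((w i %/ rho ^ (m - k)) %% rho = d)%N].

Lemma truncn_chart (y : R) m : 0 <= y < el n0 -> (n0 <= m)%N ->
  (Num.truncn (y * rho%:R ^+ m) < rho ^ (m - n0))%N.
Proof.
move=> /andP[y0 yn] nm; have X0 : 0 < rho%:R ^+ m :> R by rewrite exprn_gt0// ltr0n.
rewrite truncn_lt_nat ?mulr_ge0 ?(ltW X0)// -ltr_pdivlMr//; apply: lt_le_trans yn _.
rewrite ler_pdivlMr// /npow natrX -[in leLHS](subnKC nm) exprD mulKf//.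
by rewrite expf_neq0// pnatr_eq0 -lt0n.
Qed.

Lemma truncn_lower (y : R) k m : 0 <= y -> (k <= m)%N ->
  Num.truncn (y * rho%:R ^+ k) = (Num.truncn (y * rho%:R ^+ m) %/ rho ^ (m - k))%N.
Proof.
move=> y0 km; have r0 : rho%:R != 0 :> R by rewrite pnatr_eq0 -lt0n.
rewrite -truncn_divn ?expn_gt0 ?rho0 ?mulr_ge0 ?exprn_ge0//.
have -> : rho%:R ^+ m = rho%:R ^+ k * rho%:R ^+ (m - k) :> R by rewrite -exprD subnKC.
by rewrite natrX mulrA mulfK// expf_neq0.
Qed.

(** A point off the closed set [X] lies in a small cell disjoint from [X]. Conversely the digit
    conditions place [x] in the avoiding cell of index [j]. *)
Lemma notin_compactP (x : 'rV[R]_n) : (forall i, 0 <= chart (x ord0 i) < el n0) ->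
  (~ X x) <->
  exists j, code2 rho (fun a b => (n0 <= a)%N /\ (n0 <= b)%N /\ valid_index a b) j j /\
    forall (i : 'I_n) (d : 'I_rho) a,
      code2 rho (fun a b => (n0 <= a)%N /\ (n0 <= b)%N /\ cell_digit i d a b) j a ->
      has_digit rho d a (chart (x ord0 i)).
Proof.
move=> xI.
have xI1 i : 0 <= chart (x ord0 i) <= 1.
  by case/andP: (xI i) => -> /ltW h; rewrite (le_trans h)// npow_le1.
have x0 i : 0 <= chart (x ord0 i) by case/andP: (xI i).
split=> [nX|].
  have [eps eps0 sep] := compact_coord_separated X_compact nX.
  (* Charts of points in one cell of level [m] differ by less than [rho^-m], hence by less than
     [eps / scale]; the minimum with 1 meets the range of [npow_between]. *)
  have [|k /andP[ke _]] := @npow_between R rho (Num.min 1 (eps / scale%:R)) rho1.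
    by rewrite lt_min ltr01 divr_gt0// ge_min lexx.
  pose m := (n0 + k.+1)%N; pose w := [ffun i => Num.truncn (chart (x ord0 i) * rho%:R ^+ m)].
  have nm : (n0 <= m)%N by rewrite leq_addr.
  have X0 : 0 < rho%:R ^+ m :> R by rewrite exprn_gt0// ltr0n.
  have av : avoiding w m.
    split=> // [i|y cy]; first by rewrite ffunE; exact: truncn_chart.
    move=> Xy; apply: (sep y _ Xy) => i.
    have y0 : 0 <= chart (y ord0 i) by case/andP: (chart_itv (X_bounded Xy i)).
    have := cy i; rewrite ffunE => tE.
    have /andP[a1 a2] := truncn_itv (mulr_ge0 y0 (ltW X0)).
    have /andP[b1 b2] := truncn_itv (mulr_ge0 (x0 i) (ltW X0)).
    rewrite tE -natr1 in a1 a2; rewrite -natr1 in b2.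
    have : `|chart (x ord0 i) * rho%:R ^+ m - chart (y ord0 i) * rho%:R ^+ m| < 1.
      by rewrite ltr_norml; apply/andP; split; lra.
    rewrite -mulrBl normrM (gtr0_norm X0) -ltr_pdivlMr// div1r -/(el m) => h.
    have {}h : `|chart (x ord0 i) - chart (y ord0 i)| < eps / scale%:R.
      apply: lt_le_trans h _; apply: le_trans (_ : el k.+1 <= _).
        by rewrite ler_npow// leq_addl.
      by apply: le_trans (ltW ke) _; rewrite ge_min lexx orbT.
    move: h; rewrite /chart -mulrBl normrM [`|_^-1|]gtr0_norm ?invr_gt0// ltr_pM2r ?invr_gt0//.
    by rewrite opprD addrACA subrr addr0.
  have j0 : (n0 <= cell_index w m)%N by exact: leq_addr.
  have j1 : (0 < cell_index w m)%N by exact: leq_trans n0_gt0 j0.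
  exists (el (cell_index w m)); split.
    by exists (cell_index w m), (cell_index w m); split => //; split => //; split => //; exists w, m.
  move=> i d a [j [k' [_ k'0 /(npow_inj rho1)jE -> [_ [nk' [w' [m' []]]]]]]].
  rewrite -jE => /cell_index_inj[<- <-] k'm dE.
  by apply/has_digitP => //; rewrite (truncn_lower _ k'm)// -dE ffunE.
move=> [_ [[j [_ [j0 _ -> _ [nj [_ [w [m [[nm wlt av] jE]]]]]]]] dig]].
(* [w i] has at most [m - n0] digits, at places above [n0], all of them within the range of the
   coded relation. *)
apply: av => i; apply: (@digits_inj rho (m - n0)) => //; first exact: truncn_chart.
move=> l lm; pose k := (m - l)%N.
have km : (k <= m)%N by rewrite leq_subr.
have nk : (n0 <= k)%N by rewrite /k; clear -lm; lia.
have lE : l = (m - k)%N by rewrite /k; clear -lm; lia.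
have k0 : (0 < k)%N by exact: leq_trans n0_gt0 nk.
have dr : ((w i %/ rho ^ (m - k)) %% rho < rho)%N by exact: ltn_pmod.
have : has_digit rho (Ordinal dr) (el k) (chart (x ord0 i)).
  apply: dig; exists j, k; split => //; split=> //; split=> //.
  by exists w, m.
by move/has_digitP => /(_ rho3 k0 dr (xI1 i)) /=; rewrite lE (truncn_lower _ km).
Qed.

(** [X] is the part of the box of the chart outside all avoiding cells. Coordinates and digits range
    over finite types, so their quantifiers are finite conjunctions, and the chart is stated through
    [scale * y = x + B] to avoid division. *)
Lemma compact_definable : definable P Q X.
Proof.
pose V1 := code2 (R := R) rho (fun a b => (n0 <= a)%N /\ (n0 <= b)%N /\ valid_index a b).
pose V2 i d := code2 (R := R) rho (fun a b => (n0 <= a)%N /\ (n0 <= b)%N /\ cell_digit i d a b).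
have d1 : dset2 P Q V1 by exact: dV.
apply: (@dpred_definable _ _ _ _ _ (fun e =>
  (forall i : 'I_n, exists y, scale%:R * y = e i + B%:R /\ 0 <= y /\ y < el n0) /\
  ~ exists j, V1 j j /\ forall (i : 'I_n) (d : 'I_rho),
      forall a, V2 i d j a -> exists y, scale%:R * y = e i + B%:R /\ has_digit rho d a y)).
  apply: dpred_and; first by apply: dpred_forall_ord => i; dsolve.
  apply: dpred_not; apply: dpred_ex; cbv beta; apply: dpred_and; first by dsolve.
  apply: dpred_forall_ord => i; apply: dpred_forall_ord => d.
  have d2 : dset2 P Q (V2 i d) by exact: dV.
  by have d3 := @dd d; dsolve.
move=> x; have eE (i : 'I_n) :
    (if insub (i : nat) is Some j then x ord0 j else 0) = x ord0 i by rewrite valK.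
split=> [Xx|[xI nex]].
  have xI i : 0 <= chart (x ord0 i) < el n0 by exact/chart_itv/X_bounded.
  split=> [i|[j [Vj H]]].
    exists (chart (x ord0 i)); rewrite eE; split; first exact/chartK.
    by case/andP: (xI i).
  suff : ~ X x by [].
  apply/(notin_compactP xI); exists j; split => // i d a /H[y []].
  by rewrite eE => /chartK ->.
have {}xI i : 0 <= chart (x ord0 i) < el n0.
  by have [y [+ [y0 yn]]] := xI i; rewrite eE => /chartK <-; rewrite y0.
apply: contrapT => /(notin_compactP xI)[j [Vj H]]; apply: nex.
exists j; split => // i d a /H h; exists (chart (x ord0 i)); split => //.
by rewrite eE; exact/chartK.
Qed.

End Compact.

Unset Implicit Arguments.

Theorem theoremB (R : realType) (r s : nat) (K : {set 'I_r}) (L : {set 'I_s})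
  (hr : (3 <= r)%N) (hs : (3 <= s)%N)
  (hlog : @irrational R (ln (s%:R : R) / ln (r%:R : R)))
  (hK : forall k : 'I_r, k \in K -> (1 <= k <= r - 2)%N)
  (hL : forall l : 'I_s, l \in L -> (1 <= l <= s - 2)%N)
  (hK0 : exists k : 'I_r, k \in K) (hL0 : exists l : 'I_s, l \in L)
  (n : nat) (X : set 'rV[R]_n) (hX : compact X) :
  definable (@cantor_set R r K) (@cantor_set R s L) X.
Proof.
set P := cantor_set K; set Q := cantor_set L.
have [dAr dMr] := cantor_set_base hr hK hK0 (@dset1_P _ P Q).
have [dAs dMs] := cantor_set_base hs hL hL0 (@dset1_Q _ P Q).
have s2 : (2 <= s)%N by exact: ltnW.
(* [S] is the power for which the shift on base-[r ^ S] exponents is strictly increasing; the rest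
   takes place in that base. *)
have [S [S0 [f_homo [n0 [n00 f_n0]]]]] := lcm_shift_growth (ltnW hr) s2 hlog.
set f := lcm_shift s (r ^ S) in f_homo f_n0.
have rho3 : (3 <= r ^ S)%N.
  by apply: (leq_trans hr); rewrite -{1}(expn1 r) leq_exp2l //; exact: ltnW.
have dA := dset1_npow_exp hr S0 dAr dMr.
have dM := dset2_mult_exp hr S0 dAr dMr.
have f_ge := @lcm_shift_ge (r ^ S) s rho3 s2.
have [B XB] := compact_coord_bounded hX.
apply: (@compact_definable _ _ _ (r ^ S) n0 rho3 n00 _ _ _ _ _ hX XB).
- by move=> d; exact: dset2_has_digit dM.
(* Membership of an exponent in a coded set is digit 1 at that place. *)
- move=> V; apply: (@dset2_code2 _ _ _ (r ^ S) (has_digit (r ^ S) 1) (shift_graph (r ^ S) s) f).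
  + exact: ltnW.
  + exact: n00.
  + exact: f_homo.
  + by move=> m /f_n0[].
  + by move=> m /f_n0[].
  + by move=> m m0; exact: leq_trans m0 (f_ge m).
  + exact: has_digit_code.
  + by move=> x y [].
  + by move=> m x m0; exact: shift_graphP.
  + exact: dA.
  + exact: dset2_has_digit dM.
  + exact: dset2_shift_graph.
Qed.
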